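(* Let $m\ge 1$ be an integer, $r>0$, and for $1\le j\le m$ let $f_j$ be a non-constant analytic function on the disk $\{z\in\mathbb{C}:|z|<r\}$ with $f_j(0)\neq 0$. Let $\mathbb{D}\subset\mathbb{S}_+^m$ be a compact set and let $\mathcal{Z}:\mathbb{D}\to\{z\in\mathbb{C}:|z|<r\}$ be a continuous function such that for every $\mathbf{d}\in\mathbb{D}$, $\mathcal{Z}(\mathbf{d})$ is a strictly minimal critical point associated with the direction $\mathbf{d}$ for $(f_1,\ldots,f_m)$. Define $$F(\theta;\mathbf{d}):=i\,\theta\, d_0-\sum_{j=1}^m d_j\,\ln\left\{\frac{f_j\big(\mathcal{Z}(\mathbf{d})e^{i\theta}\big)}{f_j\big(\mathcal{Z}(\mathbf{d})\big)}\right\},\qquad H(\theta,z;\mathbf{d}):=i\,\theta\, d_0-\sum_{j=1}^m d_j\,\ln\left\{\frac{f_j(z e^{i\theta})}{f_j(z)}\right\}.$$ Then for every open disk $\Theta\subset\mathbb{C}$ centered at the origin there exists an open disk $\mathcal{B}\subset\Theta$ centered at the origin such that $F(\theta;\mathbf{d})$ is a continuous function on the set $$\Lambda:=\big(\Theta\times\mathcal{Z}^{-1}\mathcal{B}\big)\cup\big(\mathcal{B}\times\mathbb{D}\big).$$ Furthermore: (a) for each $\mathbf{d}\in\mathbb{D}$, $F(\theta;\mathbf{d})$ is an analytic function of $\theta$ (for $(\theta;\mathbf{d})\in\Lambda$) such that $F(0;\mathbf{d})=\frac{\partial F}{\partial\theta}(0;\mathbf{d})=0$; (b) for $(\theta;\mathbf{d})\in\Lambda$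 such that $\theta\in\mathbb{R}\setminus\{0\}$ and $\mathbf{d}\notin\mathcal{Z}^{-1}\{0\}$, $\Re\{F(\theta;\mathbf{d})\}>0$; and there is a continuous function $G(\theta;\mathbf{d})$ defined on $\Lambda$ such that (c) $F(\theta;\mathbf{d})=\mathcal{Z}(\mathbf{d})\cdot G(\theta;\mathbf{d})$ on $\Lambda$; and (d) for $(\theta;\mathbf{d})\in\Lambda$ such that $\mathbf{d}\in\mathcal{Z}^{-1}\{0\}$, $$G(\theta;\mathbf{d})=\frac{\partial H}{\partial z}(\theta,0;\mathbf{d})-\theta\cdot\frac{\partial^2 H}{\partial z\,\partial\theta}(0,0;\mathbf{d}).$$
   Context: Notation: $\mathbb{R}_+=[0,\infty)$. $\|\cdot\|$ is an arbitrary fixed norm on $\mathbb{R}^{m+1}$; coordinates of $\mathbf{d}\in\mathbb{R}^{m+1}$ are written $(d_0,\ldots,d_m)$. $\mathbb{S}_+^m:=\{\mathbf{d}\in\mathbb{R}_+^{m+1}:\|\mathbf{d}\|=1\}$. $\mathcal{Z}^{-1}\mathcal{B}$ denotes the preimage $\{\mathbf{d}\in\mathbb{D}:\mathcal{Z}(\mathbf{d})\in\mathcal{B}\}$, and $\mathcal{Z}^{-1}\{0\}=\{\mathbf{d}\in\mathbb{D}:\mathcal{Z}(\mathbf{d})=0\}$. Disks have finite positive radius. Critical points: given $\mathbf{d}\in\mathbb{R}_+^{m+1}$, a point $z\in\mathbb{C}$ with $|z|<r$ is a critical point associated with the direction $\mathbf{d}$ for $(f_1,\ldots,f_m)$ if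 $$\prod_{j=1}^m|f_j(z)|^{d_j}=\max_{x\in\mathbb{C}:|x|=|z|}\ \prod_{j=1}^m|f_j(x)|^{d_j}\qquad\text{and}\qquad d_0=\sum_{j=1}^m d_j\,\frac{z f_j'(z)}{f_j(z)}.$$ It is strictly minimal if the maximum is attained only at $x=z$. It is understood that $f_j(z)\ne0$ for all $1\le j\le m$ at a critical point, so that the quotients make sense, and that $0^0=1$. $\ln$ denotes the principal branch of the logarithm; that $F$ is a continuous function on $\Lambda$ includes that its defining expression makes sense there (in particular $|\mathcal{Z}(\mathbf{d})e^{i\theta}|<r$).
   Formalization: In (b), ''θ ∈ ℝ∖{0}'' is replaced by ''θ ∈ ℝ∖2πℤ'', because at nonzero multiples of 2π one has F(θ;d) = iθd₀, whose real part is 0, so (b) fails for disks Θ of radius greater than 2π. *)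

(* Defs.v *)
From HB Require Import structures.
From mathcomp Require Import all_boot all_order all_algebra.
From mathcomp Require Import complex.
From mathcomp Require Import all_classical all_reals all_analysis.

Set Implicit Arguments.
Unset Strict Implicit.
Unset Printing Implicit Defensive.

Import Order.TTheory GRing.Theory Num.Theory.
Import numFieldNormedType.Exports ComplexField.Normc.

Local Open Scope classical_set_scope.
Local Open Scope ring_scope.
Local Open Scope complex_scope.

(* The library only puts a topology on [R[i]^o]; this instance transports it to
   [R[i]], as [numFieldNormedType] does for the real fields. *)
#[export, non_forgetful_inheritance]
HB.instance Definition _ (R : realType) := NormedModule.copy R[i] (R[i])^o.

Section Complex.
Context {R : realType}.
Implicit Types (z w : R[i]) (g : R[i] -> R[i]).

Definition disk (rho : R) : set R[i] := [set z | normc z < rho].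

Definition expC z : R[i] :=
  (expR (complex.Re z))%:C * (cos (complex.Im z) +i* sin (complex.Im z)).

(* Principal argument, in ]-pi, pi] (junk value at 0). *)
Definition argC z : R :=
  if 0 <= complex.Im z then acos (complex.Re z / normc z)
  else - acos (complex.Re z / normc z).

Definition lnC z : R[i] := ln (normc z) +i* argC z.

(* Domain of the principal branch: the plane cut along ]-oo, 0]. *)
Definition slit_plane : set R[i] :=
  [set z | ~ (complex.Im z = 0 /\ complex.Re z <= 0)].

Definition analytic_at g w :=
  exists c : R[i] ^nat,
    \forall z \near w, [series c n * (z - w) ^+ n]_n @ \oo --> g z.

Definition constant_on (A : set R[i]) g :=
  exists c, forall z, A z -> g z = c.

End Complex.

Section Directions.
Context {R : realType}.

Definition is_norm n (N : 'rV[R]_n -> R) :=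
  [/\ forall x y, N (x + y) <= N x + N y,
      forall (a : R) x, N (a *: x) = `|a| * N x
    & forall x, N x = 0 -> x = 0].

Definition sphere_plus n (N : 'rV[R]_n -> R) : set 'rV[R]_n :=
  [set d : 'rV[R]_n | (forall k, 0 <= d 0 k) /\ N d = 1].

Variable m : nat.
Implicit Types (f : 'I_m -> R[i] -> R[i]) (d : 'rV[R]_m.+1).

(* Directions are d = (d_0, ..., d_m), whereas the functions f_1, ..., f_m are
   indexed by ['I_m]: the weight of [f j] is the entry of index [j + 1]. *)
Definition d0 d : R := d 0 ord0.
Definition dj d (j : 'I_m) : R := d 0 (lift ord0 j).

(* [powR] satisfies 0 `^ 0 = 1 and 0 `^ x = 0 for x <> 0. *)
Definition modulus_prod f d (x : R[i]) : R :=
  \prod_(j < m) normc (f j x) `^ dj d j.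

Definition critical_point (r : R) f d (z : R[i]) :=
  [/\ disk r z,
      forall j, f j z != 0,
      forall x, normc x = normc z -> modulus_prod f d x <= modulus_prod f d z
    & (d0 d)%:C = \sum_(j < m) (dj d j)%:C * (z * (f j)^`()%classic z / f j z)].

Definition strictly_minimal_critical_point (r : R) f d (z : R[i]) :=
  critical_point r f d z /\
  forall x, normc x = normc z -> modulus_prod f d x = modulus_prod f d z ->
    x = z.

Definition log_arg f (j : 'I_m) (theta z : R[i]) : R[i] :=
  f j (z * expC ('i * theta)) / f j z.

Definition Hfun f (theta z : R[i]) d : R[i] :=
  'i * theta * (d0 d)%:C
  - \sum_(j < m) (dj d j)%:C * lnC (log_arg f j theta z).

Definition Ffun f (Z : 'rV[R]_m.+1 -> R[i]) (theta : R[i]) d : R[i] :=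
  Hfun f theta (Z d) d.

(* The expression defining [Hfun f theta z d] makes sense when the [f j] live on
   the disk of radius r. *)
Definition H_defined (r : R) f (theta z : R[i]) :=
  [/\ disk r z, disk r (z * expC ('i * theta))
    & forall j, f j z != 0 /\ slit_plane (log_arg f j theta z)].

Definition Lambda (T B : R) (D : set 'rV[R]_m.+1) (Z : 'rV[R]_m.+1 -> R[i]) :
    set (R[i] * 'rV[R]_m.+1) :=
  (disk T `*` (D `&` Z @^-1` disk B)) `|` (disk B `*` D).

End Directions.

(* Main.v *)
(** Every logarithm can be kept inside the disk |w - 1| < 1/8. For z
    near 0 this holds for all theta in Theta, since z e^(i theta) and z are both
    small; for theta near 0 it holds on the compact set Z(D) by a covering
    argument. There the principal logarithm is a power series composed with an
    affine map, and a composition of power series is a power series, which gives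
    continuity and analyticity of F; the critical point equation is exactly
    F'(0) = 0, and strict minimality gives (b). Near z = 0, writing
    ln (f_j z / f_j 0) = z p_j(z) and using d_0 = z sum_j d_j f_j'(z) / f_j(z),
    the factor z comes out of H explicitly:
      H = z (i theta sum_j d_j f_j'(z) / f_j(z)
             - sum_j d_j (e^(i theta) p_j(z e^(i theta)) - p_j(z))),
    and G is the cofactor there and F / Z elsewhere. *)

Require Import Defs.
From HB Require Import structures.
From mathcomp Require Import all_boot all_order all_algebra.
From mathcomp Require Import complex.
From mathcomp Require Import all_classical all_reals all_analysis.
From mathcomp Require Import ring lra.

Set Implicit Arguments.
Unset Strict Implicit.
Unset Printing Implicit Defensive.

Import Order.TTheory GRing.Theory Num.Theory.
Import numFieldNormedType.Exports.

Local Open Scope classical_set_scope.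
Local Open Scope ring_scope.
Local Open Scope complex_scope.
Import ComplexField.Normc.

(** * Topology of the complex numbers *)

(** [analytic_at] asserts only pointwise convergence of a series, so uniformity has to be recovered
    first: the terms at one nearby point are bounded, which bounds the coefficients geometrically.
    One quadratic remainder estimate, uniform in both points, then yields differentiability near w
    and continuity of the derivative without any integral formula. Part (b) must leave out theta in
    2 pi Z: Theta may have radius above 2 pi, and at theta = 2 pi k the rotated point is Z(d) again,
    so that F = i theta d_0 has real part 0. With d_0 kept as a constant, H(theta, 0) = i theta d_0,
    so H is divisible by z only if d_0 = 0. Replacing d_0 through the critical point equation is
    legitimate at z = Z(d) only, whereas the derivatives in (d) move z with d fixed; those rest on
    d_0 = 0, which the same equation gives when Z(d) = 0. *)

Section ComplexTopology.
Context {R : realType}.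
Implicit Types (z w : R[i]).

Lemma normrE z : `|z| = (normc z)%:C. Proof. by []. Qed.

Lemma normc_ge0 z : 0 <= normc z.
Proof. by case: z => a b; exact: sqrtr_ge0. Qed.

Lemma normc_gt0 z : (0 < normc z) = (z != 0).
Proof. by rewrite -ltcR -normrE normr_gt0. Qed.

Lemma normcX z n : normc (z ^+ n) = normc z ^+ n.
Proof.
by apply: complexI; rewrite -normrE normrX normrE rmorphXn.
Qed.

Lemma normc_real (x : R) : normc x%:C = `|x|.
Proof. by rewrite /= expr0n addr0 sqrtr_sqr. Qed.

Lemma normc_nat n : normc n%:R = n%:R :> R.
Proof. by rewrite -(rmorph_nat (real_complex R)) normc_real ger0_norm. Qed.

Lemma normc_distC z w : normc (z - w) = normc (w - z).
Proof. by rewrite -normcN opprB. Qed.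

Lemma normc_sum (I : Type) (s : seq I) (P : pred I) (F : I -> R[i]) :
  normc (\sum_(i <- s | P i) F i) <= \sum_(i <- s | P i) normc (F i).
Proof.
elim/big_rec2 : _ => [|i x y _ h]; first by rewrite normc0.
by apply: le_trans (le_normcD _ _) _; rewrite lerD2l.
Qed.

Lemma Re_le_normc z : `|complex.Re z| <= normc z.
Proof. by rewrite -lecR normc_ge_Re. Qed.

Lemma Im_le_normc z : `|complex.Im z| <= normc z.
Proof.
case: z => a b /=; rewrite -sqrtr_sqr ler_wsqrtr// lerDr; exact: sqr_ge0.
Qed.

Lemma normc_le_ReIm z : normc z <= `|complex.Re z| + `|complex.Im z|.
Proof.
rewrite {1}[z]complexE; apply: le_trans (le_normcD _ _) _.
rewrite normcM !normc_real lerD2l /=.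
by rewrite expr0n expr1n add0r sqrtr1 mul1r.
Qed.

(** The norm of [R[i]] takes values in [R[i]], so ball radii are complex; a positive one has zero
    imaginary part, which lets all later estimates use real radii. *)
Lemma nbhs_normcP z (P : set R[i]) :
  nbhs z P <-> exists2 e : R, 0 < e & forall w, normc (w - z) < e -> P w.
Proof.
split.
  move=> /nbhs_ballP[e /= e0 eP].
  exists (complex.Re e); first by move: e0; rewrite ltcE /= => /andP[].
  move=> w we; apply: eP; rewrite -ball_normE /= distrC normrE.
  move: e0 we; case: e => a b; rewrite !ltcE /= => /andP[/eqP -> _] ->.
  by rewrite eqxx.
move=> [e e0 eP]; apply/nbhs_ballP; exists e%:C => /=; first by rewrite ltcR.
by move=> w; rewrite -ball_normE /= distrC normrE ltcR => /eP.
Qed.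

Lemma nbhs_normcI z (P Q : set R[i]) : nbhs z P -> nbhs z Q ->
  exists2 e : R, 0 < e & forall w, normc (w - z) < e -> P w /\ Q w.
Proof. by move=> zP zQ; apply/nbhs_normcP; exact: (@filterI _ (nbhs z)). Qed.

Lemma cvg_normcP T (F : set_system T) {FF : Filter F} (u : T -> R[i]) z :
  fmap u F --> z <-> normc (z - u x) @[x --> F] --> (0 : R).
Proof.
split => [/cvgrPdist_lt h|/cvgr0Pnorm_lt h].
  apply/cvgr0Pnorm_lt => e e0; have := h e%:C; rewrite ltcR => /(_ e0).
  by apply: filterS => x; rewrite normrE ltcR ger0_norm// normc_ge0.
apply/cvgrPdist_lt => -[e e']; rewrite ltcE /= => /andP[/eqP -> /h].
by apply: filterS => x; rewrite normrE ltcR ger0_norm// normc_ge0.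
Qed.

(* [fmap u F --> z] rather than [u @ F --> z]: the latter wraps F in a [nbhs],
   and unifying it with [nbhs z] unfolds the topology of R[i]. *)
Section Limits.
Context {T : Type} {F : set_system T} {FF : Filter F}.
Implicit Types (u v : T -> R[i]).

Lemma cvgC_lt u z : fmap u F --> z ->
  forall e : R, 0 < e -> \forall x \near F, normc (u x - z) < e.
Proof.
move=> /cvg_normcP/cvgr0Pnorm_lt h e /h; apply: filterS => x.
by rewrite ger0_norm ?normc_ge0// normc_distC.
Qed.

Lemma cvgC_ltW u z : (forall e : R, 0 < e -> \forall x \near F, normc (u x - z) < e) ->
  fmap u F --> z.
Proof.
move=> h; apply/cvg_normcP/cvgr0Pnorm_lt => e /h; apply: filterS => x.
by rewrite ger0_norm ?normc_ge0// normc_distC.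
Qed.

Lemma cvgC_lip u z (v : T -> R) : fmap v F --> (0 : R) ->
  (\forall x \near F, normc (u x - z) <= v x) -> fmap u F --> z.
Proof.
move=> v0 h; apply/cvg_normcP.
apply: (squeeze_cvgr _ (cvg_cst 0) v0); apply: filterS h => x hx /=.
by rewrite normc_ge0 normc_distC.
Qed.

Lemma cvgC_lip_normc u z (f : T -> R[i]) w (k : R) : fmap f F --> w ->
  (\forall x \near F, normc (u x - z) <= k * normc (f x - w)) -> fmap u F --> z.
Proof.
move=> /cvg_normcP f0; apply: (cvgC_lip (v := fun x => k * normc (f x - w))).
rewrite -(mulr0 k); apply: cvgM; first exact: cvg_cst.
by under eq_fun do rewrite normc_distC.
Qed.

Lemma cvgC_eq u v z : u =1 v -> fmap u F --> z -> fmap v F --> z.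
Proof. by move=> /funext ->. Qed.

Lemma cvgC_near_eq u v z : (\forall x \near F, u x = v x) ->
  fmap u F --> z -> fmap v F --> z.
Proof.
by move=> uv /cvgC_lt h; apply: cvgC_ltW => e /h; apply: filterS2 uv => x ->.
Qed.

Lemma cvgC_cst z : fmap (fun=> z) F --> z. Proof. exact: cvg_cst. Qed.

Lemma cvgCD u v z w : fmap u F --> z -> fmap v F --> w ->
  fmap (fun x => u x + v x) F --> z + w.
Proof. exact: cvgD. Qed.

Lemma cvgCN u z : fmap u F --> z -> fmap (fun x => - u x) F --> - z.
Proof. exact: cvgN. Qed.

Lemma cvgCB u v z w : fmap u F --> z -> fmap v F --> w ->
  fmap (fun x => u x - v x) F --> z - w.
Proof. exact: cvgB. Qed.

Lemma cvgCM u v z w : fmap u F --> z -> fmap v F --> w ->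
  fmap (fun x => u x * v x) F --> z * w.
Proof. exact: cvgM. Qed.

Lemma cvgCV u z : z != 0 -> fmap u F --> z -> fmap (fun x => (u x)^-1) F --> z^-1.
Proof. exact: cvgV. Qed.

Lemma cvgCX u z n : fmap u F --> z -> fmap (fun x => u x ^+ n) F --> z ^+ n.
Proof.
move=> uz; elim: n => [|n IH]; first exact: cvgC_cst.
rewrite exprS (_ : (fun x => _) = (fun x => u x * u x ^+ n)).
  exact: cvgCM.
by apply/funext => x; rewrite exprS.
Qed.

Lemma cvgC_sum (I : Type) (s : seq I) (P : pred I) (u : I -> T -> R[i])
    (z : I -> R[i]) : (forall i, P i -> fmap (u i) F --> z i) ->
  fmap (fun x => \sum_(i <- s | P i) u i x) F --> \sum_(i <- s | P i) z i.
Proof.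
move=> h; elim: s => [|i s IH].
  rewrite big_nil (_ : (fun x => _) = fun=> 0); first exact: cvgC_cst.
  by apply/funext => x; rewrite big_nil.
rewrite big_cons; case: ifPn => Pi.
  rewrite (_ : (fun x => _) =
    (fun x => u i x + \sum_(i <- s | P i) u i x)).
    by apply: cvgCD; [exact: h | exact: IH].
  by apply/funext => x; rewrite big_cons Pi.
rewrite (_ : (fun x => _) = (fun x => \sum_(i <- s | P i) u i x))//.
by apply/funext => x; rewrite big_cons (negbTE Pi).
Qed.

Lemma cvgC_ReIm u z : fmap (fun x => complex.Re (u x)) F --> complex.Re z ->
  fmap (fun x => complex.Im (u x)) F --> complex.Im z -> fmap u F --> z.
Proof.
move=> hr hi; apply: (@cvgC_lip _ _
  (fun x => `|complex.Re (u x) - complex.Re z| + `|complex.Im (u x) - complex.Im z|)).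
  rewrite -[X in _ --> X]addr0; apply: cvgD.
    apply/norm_cvg0P; rewrite -[X in _ --> X](subrr (complex.Re z)).
    by apply: cvgB => //; exact: cvg_cst.
  apply/norm_cvg0P; rewrite -[X in _ --> X](subrr (complex.Im z)).
  by apply: cvgB => //; exact: cvg_cst.
by apply: nearW => x; rewrite -!raddfB; exact: normc_le_ReIm.
Qed.

Lemma cvg_real (u : T -> R) (a : R) : fmap u F --> a ->
  fmap (fun x => (u x)%:C) F --> a%:C.
Proof. by move=> ua; apply: cvgC_ReIm => //=; exact: cvg_cst. Qed.

End Limits.

Lemma cvgC_unique (T : Type) (F : set_system T) {FF : ProperFilter F}
  (u : T -> R[i]) z w : fmap u F --> z -> fmap u F --> w -> z = w.
Proof. by move=> uz uw; apply: (cvg_unique _ uz uw). Qed.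

End ComplexTopology.

(** * Complex derivatives *)

Local Notation is_cderive x f l := (is_derive (x : _[i]) (1 : _[i]) f l).

Section ComplexDerivative.
Context {R : realType}.
Implicit Types (z w l k : R[i]) (f g q : R[i] -> R[i]).

(* Caratheodory's form of the derivative, from which the chain rule is immediate. *)
Lemma is_cderiveP z f l : is_cderive z f l <->
  exists2 q, q @ z --> l & forall w, f w = f z + q w * (w - z).
Proof.
have E : (fun h : R[i] => h^-1 *: ((f \o shift z) (h *: (1 : R[i])) - f z)) =
    (fun h => h^-1 * (f (h + z) - f z)).
  by apply/funext => h; rewrite /= /GRing.scale /= mulr1.
split=> [[dv dvE]|[q /cvgC_lt qz qE]].
  exists (fun w => if w == z then l else (f w - f z) / (w - z)); last first.
    move=> w; case: eqVneq => [->|wz]; first by rewrite subrr mulr0 addr0.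
    by rewrite divfK ?subr_eq0// addrC subrK.
  have /cvgC_lt h : (fun h => h^-1 * (f (h + z) - f z)) @ (0 : R[i])^' --> l.
    by move: dv; rewrite /derivable -dvE /derive E.
  apply: cvgC_ltW => e e0.
  have /nbhs_normcP[d d0 dP] := h e e0.
  apply/nbhs_normcP; exists d => // w wd.
  case: eqVneq => [_|wz].
    by rewrite subrr normc0.
  have := dP (w - z); rewrite subr0 subrK mulrC; apply => //.
  by rewrite subr_eq0.
have h : (fun h : R[i] => h^-1 *: ((f \o shift z) (h *: (1 : R[i])) - f z))
    @ (0 : R[i])^' --> l.
  rewrite E; apply: cvgC_ltW => e e0.
  have /nbhs_normcP[d d0 dP] := qz e e0.
  apply/nbhs_normcP; exists d => // w; rewrite subr0 => wd w0.
  rewrite qE addrAC subrr add0r addrK.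
  by rewrite mulrC mulfK//; apply: dP; rewrite addrK.
split; first by apply/cvg_ex; exists l.
exact/cvg_lim.
Qed.

Lemma is_cderive_continuous z f l : is_cderive z f l -> f @ z --> f z.
Proof.
move=> /is_cderiveP[q qz qE].
have h : fmap (fun w => f z + q w * (w - z)) (nbhs z) --> f z + l * (z - z).
  apply: cvgCD; first exact: cvgC_cst.
  by apply: cvgCM; [exact: qz|apply: cvgCB; [exact: cvg_id|exact: cvgC_cst]].
rewrite subrr mulr0 addr0 in h.
have E : f = (fun w => f z + q w * (w - z)) by exact/funext.
by rewrite {1}E.
Qed.

Lemma is_cderive_comp z f g l k : is_cderive z f l -> is_cderive (f z) g k ->
  is_cderive z (fun w => g (f w)) (k * l).
Proof.
move=> fl; have fc := is_cderive_continuous fl.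
move: fl => /is_cderiveP[q qz qE] /is_cderiveP[p pz pE].
apply/is_cderiveP; exists (fun w => p (f w) * q w).
  by apply: cvgCM; [exact: (cvg_comp _ _ fc pz)|exact: qz].
by move=> w; rewrite pE {2}(qE w) addrAC subrr add0r mulrA.
Qed.

Lemma is_cderive_cst z k : is_cderive z (fun=> k) 0.
Proof. exact: is_derive_cst. Qed.

Lemma is_cderive_id z : is_cderive z (fun w => w) 1.
Proof. exact: is_derive_id. Qed.

Lemma is_cderiveD z f g l k : is_cderive z f l -> is_cderive z g k ->
  is_cderive z (fun w => f w + g w) (l + k).
Proof. exact: is_deriveD. Qed.

Lemma is_cderiveN z f l : is_cderive z f l ->
  is_cderive z (fun w => - f w) (- l).
Proof. exact: is_deriveN. Qed.

Lemma is_cderiveB z f g l k : is_cderive z f l -> is_cderive z g k ->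
  is_cderive z (fun w => f w - g w) (l - k).
Proof. exact: is_deriveB. Qed.

Lemma is_cderiveM z f g l k : is_cderive z f l -> is_cderive z g k ->
  is_cderive z (fun w => f w * g w) (f z * k + g z * l).
Proof. exact: is_deriveM. Qed.

Lemma is_cderiveZ z f l k : is_cderive z f l ->
  is_cderive z (fun w => k * f w) (k * l).
Proof. exact: is_deriveZ. Qed.

Lemma is_cderive_sum z n (f : 'I_n -> R[i] -> R[i]) (l : 'I_n -> R[i]) :
  (forall j, is_cderive z (f j) (l j)) ->
  is_cderive z (fun w => \sum_(j < n) f j w) (\sum_(j < n) l j).
Proof.
move=> h; have := @is_derive_sum _ _ _ n f z 1 l h.
by congr is_derive; apply/funext => w; rewrite fct_sumE.
Qed.

Lemma is_cderive_near z f g l : (\forall w \near z, f w = g w) ->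
  is_cderive z f l -> is_cderive z g l.
Proof. exact: near_eq_is_derive. Qed.

Lemma is_cderive_mul0 f : f @ (0 : R[i]) --> f 0 ->
  is_cderive 0 (fun w => w * f w) (f 0).
Proof.
move=> fc; apply/is_cderiveP; exists f => // w.
by rewrite mul0r add0r subr0 mulrC.
Qed.

(** The mean value theorem concerns real functions, so the real part is followed along the segment
    from 0 to z. *)
Lemma is_cderive_cst_ball (rho : R) g :
  (forall z, normc z < rho -> is_cderive z g 0) ->
  forall z, normc z < rho -> g z = g 0.
Proof.
suff H f : (forall z, normc z < rho -> is_cderive z f 0) ->
    forall z, normc z < rho -> complex.Re (f z) = complex.Re (f 0).
  move=> h z zr; apply/eqP; rewrite eq_complex H//= eqxx /=.
  (* The real part of [- 'i * g] is the imaginary part of [g]. *)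
  have h' w : normc w < rho -> is_cderive w (fun w => - 'i * g w) 0.
    by move=> /h/(is_cderiveZ (- 'i)); rewrite mulr0.
  have := H _ h' z zr; move: (g z) (g 0) => [a b] [c d] /=.
  by rewrite !mulN1r !opprK !oppr0 !mul0r !add0r => ->.
move=> h z zr; pose phi (t : R) := complex.Re (f (t%:C * z)).
have phiE (t : R) : t \in `[0, 1] -> is_derive t 1 phi 0.
  rewrite in_itv /= => /andP[t0 t1].
  have /h/is_cderiveP[q /cvgC_lt qz qE] : normc (t%:C * z) < rho.
    rewrite normcM normc_real ger0_norm//.
    by apply: le_lt_trans zr; rewrite ler_piMl ?normc_ge0.
  (* The difference quotient of [phi] is bounded by |q| |z|, and q tends to the derivative 0. *)
  have hh : (fun s : R => s^-1 *: ((phi \o shift t) (s *: (1 : R)) - phi t))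
      @ (0 : R)^' --> (0 : R).
    apply/cvgr0Pnorm_lt => e e0.
    (* The summand 1 keeps the denominator positive when z = 0. *)
    have z0 : 0 < normc z + 1 by rewrite ltr_wpDl ?normc_ge0.
    have ez : 0 < e / (normc z + 1) by rewrite divr_gt0.
    have /nbhs_normcP[d d0 dP] := qz _ ez.
    apply/nbhs_ballP; exists (d / (normc z + 1)) => /=; first by rewrite divr_gt0.
    move=> s; rewrite -ball_normE /= sub0r normrN => sd s0.
    have sE : (s + t)%:C * z - t%:C * z = s%:C * z.
      by rewrite rmorphD /= mulrDl addrK.
    have dP' : normc (q ((s + t)%:C * z)) < e / (normc z + 1).
      rewrite -[q _]subr0; apply: dP; rewrite sE normcM normc_real.
      apply: le_lt_trans (_ : `|s| * (normc z + 1) < d).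
        by rewrite ler_wpM2l// lerDl.
      by rewrite -ltr_pdivlMr.
    rewrite /phi /= /GRing.scale /= mulr1 (qE ((s + t)%:C * z)) sE.
    rewrite raddfD /= addrAC subrr add0r mulrCA.
    rewrite normrM normfV.
    have -> : complex.Re (s%:C * (q ((s + t)%:C * z) * z)) =
        s * complex.Re (q ((s + t)%:C * z) * z).
      by case: (q _ * z) => a b /=; rewrite mul0r subr0.
    rewrite normrM mulKf ?normr_eq0//.
    apply: le_lt_trans (Re_le_normc _) _; rewrite normcM.
    apply: le_lt_trans (_ : normc (q ((s + t)%:C * z)) * (normc z + 1) < e).
      by rewrite ler_wpM2l ?normc_ge0// lerDl.
    by rewrite -ltr_pdivlMr.
  split; first by apply/cvg_ex; exists 0.
  exact/cvg_lim.
have dphi (t : R) : t \in `]0, 1[ -> is_derive t 1 phi 0.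
  by move=> /subset_itv_oo_cc; exact: phiE.
have cphi : {within `[0, 1], continuous phi}.
  apply: derivable_within_continuous => x xI.
  by have [] := phiE x xI.
have [c _] := @MVT_segment R phi (fun=> 0) 0 1 ler01 dphi cphi.
rewrite mul0r /phi mul1r mul0r => /eqP.
by rewrite subr_eq0 => /eqP.
Qed.

End ComplexDerivative.

(** * Geometrically dominated series *)

Section GeometricDomination.
Context {R : realType}.
Implicit Types (u v : nat -> R[i]) (z w : R[i]).

Lemma cvgC_dist_le (T : Type) (F : set_system T) {FF : ProperFilter F}
    (f : T -> R[i]) z w (b : R) : fmap f F --> z ->
  (\forall x \near F, normc (f x - w) <= b) -> normc (z - w) <= b.
Proof.
move=> /cvgC_lt fz fw; apply/ler_addgt0Pr => e e0.
have [x [xz xw]] : exists x, normc (f x - z) < e /\ normc (f x - w) <= b.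
  exact: (@filter_ex _ F _ _ (filterI (fz e e0) fw)).
rewrite (_ : z - w = (f x - w) + (z - f x)); last by ring.
apply: le_trans (le_normcD _ _) _; rewrite lerD// normc_distC; exact: ltW.
Qed.

Lemma sum_geometric_le (q : R) m n : 0 <= q <= 2^-1 ->
  \sum_(m <= k < n) q ^+ k <= 2 * q ^+ m.
Proof.
move=> /andP[q0 q1]; have [mn|nm] := leqP m n; last first.
  by rewrite big_geq 1?ltnW// mulr_ge0// exprn_ge0.
(* Adding the bound 2 q^n for the remaining tail makes the induction close: q^n + 2 q^(n+1) <= 2 q^n
   because q <= 1/2. *)
suff : \sum_(m <= k < n) q ^+ k + 2 * q ^+ n <= 2 * q ^+ m.
  by apply: le_trans; rewrite lerDl mulr_ge0// exprn_ge0.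
elim: n mn => [|n IH].
  by rewrite leqn0 => /eqP ->; rewrite big_geq// add0r.
rewrite leq_eqVlt => /orP[/eqP ->|mn]; first by rewrite big_geq// add0r.
apply: le_trans (IH mn); rewrite big_nat_recr//= -addrA lerD2l exprS.
have : 0 <= q ^+ n by exact: exprn_ge0.
by move: (q ^+ n) => x x0; nra.
Qed.

Lemma geometric_small (a q e : R) : 0 <= q <= 2^-1 -> 0 < e ->
  exists n, a * q ^+ n < e.
Proof.
move=> /andP[q0 q1] e0.
have : (fun n => a * q ^+ n) @ \oo --> a * 0.
  apply: cvgM; first exact: cvg_cst.
  by apply: cvg_expr; rewrite ger0_norm//; lra.
rewrite mulr0 => /cvgr_lt/(_ e e0) h.
by have [n hn] := @filter_ex _ \oo _ _ h; exists n.
Qed.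

Section Dominated.
Variables (a q : R) (a0 : 0 <= a) (q01 : 0 <= q <= 2^-1).

Lemma sum_dominated_le u m n : (forall k, normc (u k) <= a * q ^+ k) ->
  normc (\sum_(m <= k < n) u k) <= 2 * a * q ^+ m.
Proof.
move=> ua; apply: le_trans (normc_sum _ _ _) _.
apply: le_trans (_ : \sum_(m <= k < n) a * q ^+ k <= _).
  by apply: ler_sum => k _; exact: ua.
rewrite -mulr_sumr [2 * a]mulrC -mulrA ler_wpM2l//.
exact: sum_geometric_le.
Qed.

Lemma series_dominated_tail u (s : R[i]) m : (forall k, normc (u k) <= a * q ^+ k) ->
  fmap (series u) \oo --> s -> normc (s - series u m) <= 2 * a * q ^+ m.
Proof.
move=> ua us; apply: (cvgC_dist_le us); exists m => //= n /= mn.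
by rewrite /series /= (big_cat_nat (leq0n _) mn) //= addrAC subrr add0r sum_dominated_le.
Qed.

Lemma series_dominated_le u (s : R[i]) : (forall k, normc (u k) <= a * q ^+ k) ->
  fmap (series u) \oo --> s -> normc s <= 2 * a.
Proof.
move=> ua /(series_dominated_tail 0 ua).
by rewrite /series /= big_geq// subr0 expr0 mulr1.
Qed.

Lemma series_dominated_cvg u : (forall k, normc (u k) <= a * q ^+ k) ->
  exists s : R[i], fmap (series u) \oo --> s.
Proof.
move=> ua.
have H (v : nat -> R) : (forall k, `|v k| <= a * q ^+ k) -> cvgn (series v).
  move=> va; apply: normed_cvg.
  apply: (@series_le_cvg R _ (geometric a q)) => //=.
  - by move=> n; rewrite mulr_ge0// exprn_ge0//; case/andP: q01.
  - by apply: is_cvg_geometric_series; move: q01 => /andP[? ?]; rewrite ger0_norm//; lra.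
have hr := H (fun k => complex.Re (u k)) (fun k => le_trans (Re_le_normc _) (ua k)).
have hi := H (fun k => complex.Im (u k)) (fun k => le_trans (Im_le_normc _) (ua k)).
exists (limn (series (fun k => complex.Re (u k)))
  +i* limn (series (fun k => complex.Im (u k)))).
apply: cvgC_ReIm => /=.
  rewrite (_ : (fun x => _) = series (fun k => complex.Re (u k)))//.
  by apply/funext => n; rewrite /series /= raddf_sum.
rewrite (_ : (fun x => _) = series (fun k => complex.Im (u k)))//.
by apply/funext => n; rewrite /series /= raddf_sum.
Qed.

(** Dominated convergence for series. The summation bound moves with the row index, as it does for
    partial sums of a composed series. *)
Lemma tannery (u : nat -> nat -> R[i]) v (s : R[i]) :
  (forall m n, normc (u m n) <= a * q ^+ n) ->
  (forall n, fmap (u ^~ n) \oo --> v n) ->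
  fmap (series v) \oo --> s ->
  fmap (fun m => \sum_(0 <= n < m) u m n) \oo --> s.
Proof.
move=> ua uv vs; apply: cvgC_ltW => e e0.
have va n : normc (v n) <= a * q ^+ n.
  rewrite -[v n]subr0; apply: (cvgC_dist_le (uv n)).
  by apply: nearW => m; rewrite subr0.
(* Three errors of at most e / 4 each: the first N columns and the two tails beyond N. *)
have e4 : 0 < e / 4 by rewrite divr_gt0.
have [N hN] := geometric_small (2 * a) q01 e4.
have /cvgC_lt/(_ _ e4) h : fmap (fun m => \sum_(0 <= n < N) u m n) \oo -->
    \sum_(0 <= n < N) v n by apply: cvgC_sum => n _; exact: uv.
near=> m.
have Nm : (N <= m)%N by near: m; exists N.
rewrite (big_cat_nat (leq0n _) Nm) //=.
rewrite (_ : _ - s = (\sum_(0 <= n < N) u m n - \sum_(0 <= n < N) v n) +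
  (\sum_(N <= n < m) u m n - (s - series v N))); last first.
  by rewrite /series /=; ring.
apply: le_lt_trans (le_normcD _ _) _.
have h1 : normc (\sum_(0 <= n < N) u m n - \sum_(0 <= n < N) v n) < e / 4.
  by near: m; exact: h.
have h2 : normc (\sum_(N <= n < m) u m n - (s - series v N)) <= e / 4 + e / 4.
  apply: le_trans (le_normcD _ _) _; rewrite normcN lerD//.
    by apply: le_trans (ltW hN); exact: sum_dominated_le.
  by apply: le_trans (ltW hN); exact: series_dominated_tail.
lra.
Unshelve. all: by end_near. Qed.

End Dominated.
End GeometricDomination.

(** * Power series *)

Section PowerSeries.
Context {R : realType}.
Implicit Types (g : R[i] -> R[i]) (z w : R[i]) (c : nat -> R[i]).

(** The radius is an eighth of 1 / M so that the factors n <= 2^n and n^2 <= 4^n produced by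
    differentiation still leave geometric ratios of at most 1/2. *)
Definition power_series_at g w c (C M : R) :=
  [/\ 0 < C, 0 < M, forall n, normc (c n) <= C * M ^+ n
    & forall z, normc (z - w) * M <= 8^-1 ->
        fmap (series (fun n => c n * (z - w) ^+ n)) \oo --> g z].

(** Convergence at a single point z1 at distance e / 2 suffices: its partial sums are eventually
    within 1 of the limit, so its terms are eventually at most 2, and M = 2 / e. The constant C also
    covers the finitely many earlier terms. *)
Lemma analytic_at_power_series g w : analytic_at g w ->
  exists c C M, power_series_at g w c C M.
Proof.
move=> [c /nbhs_normcP[e e0 eP]]; exists c.
pose z1 := w + (e / 2)%:C.
have z1w : z1 - w = (e / 2)%:C by rewrite /z1 addrAC subrr add0r.
have e2 : 0 < e / 2 by rewrite divr_gt0.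
have cvg1 : fmap (series (fun n => c n * (z1 - w) ^+ n)) \oo --> g z1.
  by apply: eP; rewrite z1w normc_real ger0_norm ?ltW//; lra.
have [N _ NP] := cvgC_lt cvg1 (@ltr01 R).
have bnd n : (N <= n)%N -> normc (c n * (z1 - w) ^+ n) <= 2.
  move=> Nn.
  have -> : c n * (z1 - w) ^+ n =
      (series (fun n => c n * (z1 - w) ^+ n) n.+1 - g z1) -
      (series (fun n => c n * (z1 - w) ^+ n) n - g z1).
    by rewrite /series /= big_nat_recr//=; ring.
  apply: le_trans (le_normcD _ _) _; rewrite normcN.
  have h1 := NP n Nn; have h2 := NP n.+1 (leqW Nn).
  by rewrite (le_trans (ltW (ltrD h2 h1))).
pose C := 2 + \sum_(k < N) normc (c k * (z1 - w) ^+ k).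
exists C, (e / 2)^-1; split.
- by rewrite ltr_pwDl// sumr_ge0// => k _; exact: normc_ge0.
- by rewrite invr_gt0.
- move=> n; rewrite exprVn -ler_pdivrMr ?invr_gt0 ?exprn_gt0// invrK.
  have -> : normc (c n) * (e / 2) ^+ n = normc (c n * (z1 - w) ^+ n).
    by rewrite normcM normcX z1w normc_real ger0_norm// ltW.
  have [Nn|nN] := leqP N n.
    by rewrite (le_trans (bnd _ Nn))// lerDl sumr_ge0// => k _; exact: normc_ge0.
  rewrite /C (bigD1 (Ordinal nN))//= addrCA lerDl addr_ge0//.
  by rewrite sumr_ge0// => k _; exact: normc_ge0.
- move=> z zw; apply: eP; move: zw.
  by rewrite -ler_pdivlMr ?invr_gt0// invrK; lra.
Qed.

Lemma leq_expr2 n : n%:R <= (2 : R) ^+ n.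
Proof. by rewrite -natrX ler_nat ltnW// ltn_expl. Qed.

(** Second-order Taylor remainder of a monomial. The remainders satisfy E(n+1) = y E(n) + n (y -
    z)^2 z^(n-1), and n^2 + n <= (n+1)^2; the factor t^2 on the left avoids the exponent n - 2. *)
Lemma pow_quad_le (y z : R[i]) (t : R) n : 0 < t -> normc y <= t -> normc z <= t ->
  normc (y ^+ n - z ^+ n - n%:R * (y - z) * z ^+ n.-1) * t ^+ 2 <=
  normc (y - z) ^+ 2 * (n%:R ^+ 2 * t ^+ n).
Proof.
move=> t0 yt zt; elim: n => [|n IH].
  by rewrite !expr0 subrr !mul0r subr0 normc0 expr0n !mul0r mulr0.
have -> : y ^+ n.+1 - z ^+ n.+1 - n.+1%:R * (y - z) * z ^+ n.+1.-1 =
    y * (y ^+ n - z ^+ n - n%:R * (y - z) * z ^+ n.-1) +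
    n%:R * (y - z) ^+ 2 * z ^+ n.-1.
  by case: n {IH} => [|n]; rewrite /= ?expr0 ?expr1 ?mul0r ?exprS -?natr1; ring.
set E := y ^+ n - _ - _ in IH *; set h := normc (y - z) in IH *.
have tn : 0 <= t ^+ n by rewrite exprn_ge0 ?(ltW t0).
have h1 : normc (y * E) * t ^+ 2 <= t * (h ^+ 2 * (n%:R ^+ 2 * t ^+ n)).
  rewrite normcM -mulrA; apply: ler_pM => //; rewrite ?normc_ge0//.
  by rewrite mulr_ge0 ?normc_ge0// exprn_ge0// ltW.
have h2 : normc (n%:R * (y - z) ^+ 2 * z ^+ n.-1) * t ^+ 2 <=
    n%:R * h ^+ 2 * (t * t ^+ n).
  case: n {IH E h1} tn => [|n] tn; first by rewrite !mul0r normc0 mul0r.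
  rewrite !normcM !normcX normc_nat -!mulrA.
  rewrite ler_wpM2l// ler_wpM2l ?exprn_ge0 ?normc_ge0//=.
  rewrite (_ : t * t ^+ n.+1 = t ^+ n * t ^+ 2); last by rewrite exprS; ring.
  rewrite ler_wpM2l ?normc_ge0// ler_wpM2r ?exprn_ge0 ?(ltW t0)//.
  by apply: lerXn2r; rewrite ?nnegrE ?normc_ge0 ?(ltW t0).
have : normc (y * E + n%:R * (y - z) ^+ 2 * z ^+ n.-1) * t ^+ 2 <=
   t * (h ^+ 2 * (n%:R ^+ 2 * t ^+ n)) + n%:R * h ^+ 2 * (t * t ^+ n).
  apply: le_trans (lerD h1 h2); rewrite -mulrDl ler_wpM2r ?exprn_ge0 ?(ltW t0)//.
  exact: le_normcD.
move=> /le_trans; apply; rewrite [t ^+ n.+1]exprS -[n.+1%:R]natr1.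
rewrite [leRHS](_ : _ = t * (h ^+ 2 * (n%:R ^+ 2 * t ^+ n)) +
  n%:R * h ^+ 2 * (t * t ^+ n) + (n%:R + 1) * h ^+ 2 * (t * t ^+ n)); last by ring.
by rewrite lerDl !mulr_ge0 ?addr_ge0 ?exprn_ge0 ?normc_ge0 ?(ltW t0).
Qed.

(** The remainder of g is the sum of the remainders of its monomials. The bound is uniform in y and
    z, so it serves at every point of the small disk and not only at its centre. *)
Lemma power_series_quad g w c C M z (l : R[i]) : power_series_at g w c C M ->
  normc (z - w) * M <= 8^-1 ->
  fmap (series (fun n => n%:R * c n * (z - w) ^+ n.-1)) \oo --> l ->
  forall y, normc (y - w) * M <= 8^-1 ->
  normc (g y - g z - l * (y - z)) <= 128 * C * M ^+ 2 * normc (y - z) ^+ 2.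
Proof.
move=> [C0 M0 cb gP] zw lP y yw.
pose E n := c n * ((y - w) ^+ n - (z - w) ^+ n - n%:R * (y - z) * (z - w) ^+ n.-1).
have EP : fmap (series E) \oo --> g y - g z - l * (y - z).
  apply: (cvgC_eq _ (cvgCB (cvgCB (gP y yw) (gP z zw))
    (cvgCM lP (@cvgC_cst _ _ _ _ (y - z))))) => n.
  rewrite /series /= mulr_suml -!sumrB.
  by apply: eq_bigr => k _; rewrite /E; ring.
(* Dividing by t^2 produces the constant 64 M^2, and summing against 2^-n doubles it to 128 M^2. *)
pose t := (8 * M)^-1.
have t0 : 0 < t by rewrite invr_gt0 mulr_gt0.
have tE u : normc u * M <= 8^-1 -> normc u <= t.
  by rewrite /t invfM ler_pdivlMr.
have Eb n : normc (E n) <= (64 * C * M ^+ 2 * normc (y - z) ^+ 2) * 2^-1 ^+ n.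
  have := pow_quad_le n t0 (tE _ yw) (tE _ zw).
  rewrite (_ : y - w - (z - w) = y - z); last by ring.
  rewrite -ler_pdivlMr ?exprn_gt0// => hq.
  rewrite normcM; apply: le_trans (ler_pM _ _ (cb n) hq) _; rewrite ?normc_ge0//.
  rewrite /t !exprVn invrK !exprMn.
  have n2 : n%:R ^+ 2 <= (4 : R) ^+ n.
    have -> : (4 : R) ^+ n = (2 ^+ n) ^+ 2 by rewrite exprAC; congr (_ ^+ _); ring.
    by apply: lerXn2r; rewrite ?nnegrE// leq_expr2.
  have -> : C * M ^+ n * (normc (y - z) ^+ 2 * (n%:R ^+ 2 * (8 ^+ n * M ^+ n)^-1) *
      (8 ^+ 2 * M ^+ 2)) =
     (64 * C * M ^+ 2 * normc (y - z) ^+ 2) * (n%:R ^+ 2 / 8 ^+ n).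
    field; rewrite !expf_neq0//; exact: lt0r_neq0.
  rewrite ler_wpM2l// ?mulr_ge0 ?exprn_ge0 ?normc_ge0 ?(ltW C0, ltW M0)//.
  rewrite ler_pdivrMr ?exprn_gt0// -exprVn -exprMn.
  by rewrite (_ : 2^-1 * 8 = 4 :> R)//; lra.
apply: le_trans (series_dominated_le _ _ Eb EP) _.
- by rewrite !mulr_ge0 ?exprn_ge0 ?normc_ge0 ?(ltW C0, ltW M0).
- by rewrite lexx andbT invr_ge0.
- by rewrite !mulrA -natrM.
Qed.

Lemma power_series_deriv_cvg g w c C M z : power_series_at g w c C M ->
  normc (z - w) * M <= 8^-1 ->
  exists l : R[i], fmap (series (fun n => n%:R * c n * (z - w) ^+ n.-1)) \oo --> l.
Proof.
move=> [C0 M0 cb gP] zw.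
apply: (@series_dominated_cvg _ (8 * C * M) 4^-1).
- by rewrite !mulr_ge0// ltW.
- by rewrite invr_ge0//= lef_pV2 ?posrE//; lra.
move=> [|n]; first by rewrite !mul0r normc0 !mulr_ge0 ?exprn_ge0 ?(ltW C0, ltW M0).
rewrite !normcM normcX normc_nat /=.
have h1 : n.+1%:R * normc (c n.+1) <= 2 ^+ n.+1 * (C * M ^+ n.+1).
  by apply: ler_pM; rewrite ?normc_ge0// leq_expr2.
have h2 : normc (z - w) ^+ n <= (8 * M)^-1 ^+ n.
  apply: lerXn2r; rewrite ?nnegrE ?normc_ge0 ?invr_ge0 ?mulr_ge0 ?(ltW C0, ltW M0)//.
  by rewrite invfM ler_pdivlMr.
apply: le_trans (ler_pM _ _ h1 h2) _; rewrite ?mulr_ge0 ?exprn_ge0 ?normc_ge0//.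
rewrite [leLHS](_ : _ = 8 * C * M * 4^-1 ^+ n.+1)//.
rewrite !exprS !exprVn exprMn (_ : 8 = 2 * 4 :> R) ?exprMn; last by rewrite -natrM.
by field; rewrite !expf_neq0//; exact: lt0r_neq0.
Qed.

Lemma is_cderive_quad g z (l : R[i]) (K d : R) : 0 < d ->
  (forall y, normc (y - z) < d -> normc (g y - g z - l * (y - z)) <= K * normc (y - z) ^+ 2) ->
  is_cderive z g l.
Proof.
move=> d0 H; apply/is_cderiveP.
exists (fun w => if w == z then l else (g w - g z) / (w - z)); last first.
  move=> w; case: eqVneq => [->|wz]; first by rewrite subrr mulr0 addr0.
  by rewrite divfK ?subr_eq0// addrC subrK.
apply: cvgC_ltW => e e0.
have K0 : 0 < `|K| + 1 by rewrite ltr_wpDl.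
apply/nbhs_normcP; exists (Num.min d (e / (`|K| + 1))).
  by rewrite lt_min d0 divr_gt0.
move=> w; rewrite lt_min => /andP[wd we].
case: eqVneq => [_|wz]; first by rewrite subrr normc0.
have wz0 : w - z != 0 by rewrite subr_eq0.
have n0 : 0 < normc (w - z) by rewrite normc_gt0.
rewrite (_ : _ - l = (g w - g z - l * (w - z)) / (w - z)); last by field.
rewrite normcM normcV ltr_pdivrMr//.
apply: le_lt_trans (H w wd) _; rewrite expr2 mulrA ltr_pM2r//.
apply: le_lt_trans (_ : (`|K| + 1) * normc (w - z) < e).
  by rewrite ler_wpM2r ?normc_ge0// (le_trans (ler_norm _))// lerDl.
by rewrite mulrC -ltr_pdivlMr.
Qed.

Lemma power_series_center g w c C M : power_series_at g w c C M -> g w = c 0%N.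
Proof.
move=> [_ _ _ gP]; have ww : normc (w - w) * M <= 8^-1 by rewrite subrr normc0 mul0r.
apply: (cvgC_unique (gP w ww)).
apply: (@cvgC_lip _ _ _ _ _ _ (fun=> 0)); first exact: cvg_cst.
exists 1%N => //= n /= n0; rewrite /series /= big_ltn// expr0 mulr1.
rewrite big_nat_cond big1 ?addr0 ?subrr ?normc0//.
by move=> [|i]//= _; rewrite expr0n mulr0.
Qed.

Lemma power_series_is_cderive g w c C M : power_series_at g w c C M ->
  is_cderive w g (c 1%N).
Proof.
move=> gP; have [C0 M0 _ _] := gP.
have M8 : 0 < (8 * M)^-1 by rewrite invr_gt0 mulr_gt0.
apply: (is_cderive_quad M8) => y yw.
apply: (power_series_quad gP); first by rewrite subrr normc0 mul0r.
  apply: (@cvgC_lip _ _ _ _ _ _ (fun=> 0)); first exact: cvg_cst.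
  exists 2%N => //= n /= n0; rewrite /series /= big_ltn 1?ltnW// big_ltn//.
  rewrite big_nat_cond big1 ?addr0; last first.
    by move=> [|[|i]]//= _; rewrite subrr expr0n mulr0.
  by rewrite !mul0r add0r mul1r expr0 mulr1 subrr normc0.
by rewrite -ler_pdivlMr// -invfM ltW.
Qed.

End PowerSeries.

(** * Analytic functions *)

Section Analytic.
Context {R : realType}.
Implicit Types (f g h : R[i] -> R[i]) (z w : R[i]) (c : nat -> R[i]).

Lemma is_cderive_derive1 g z (l : R[i]) : is_cderive z g l -> g^`()%classic z = l.
Proof. by move=> [_ <-]; rewrite derive1E. Qed.

(** Here both points vary in one disk: fixing z gives the derivative at z, and varying z compares
    derivatives at different points. *)
Lemma analytic_quad g w : analytic_at g w -> exists l K d,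
  [/\ 0 <= K, 0 < d & forall z y : R[i], normc (z - w) < d -> normc (y - w) < d ->
    normc (g y - g z - l z * (y - z)) <= K * normc (y - z) ^+ 2].
Proof.
move=> /analytic_at_power_series[c [C [M gP]]].
have [C0 M0 _ _] := gP.
(* The default 0 makes [l] total; inside the disk it is the sum of the derived series. *)
have H z : exists l : R[i], normc (z - w) * M <= 8^-1 ->
    fmap (series (fun n => n%:R * c n * (z - w) ^+ n.-1)) \oo --> l.
  have [zw|zw] := boolP (normc (z - w) * M <= 8^-1); last by exists 0.
  by have [l lP] := power_series_deriv_cvg gP zw; exists l.
exists (fun z => projT1 (cid (H z))), (128 * C * M ^+ 2), (8 * M)^-1.
split; first by rewrite !mulr_ge0 ?exprn_ge0 ?(ltW C0, ltW M0).
  by rewrite invr_gt0 mulr_gt0.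
have dP u : normc u < (8 * M)^-1 -> normc u * M <= 8^-1.
  by rewrite invfM -ler_pdivlMr//; exact: ltW.
move=> z y /dP zw /dP yw; apply: (power_series_quad gP zw) => //.
by case: cid => l /= /(_ zw).
Qed.

Lemma analytic_is_cderive_near g w : analytic_at g w ->
  \forall z \near w, is_cderive z g (g^`()%classic z).
Proof.
move=> /analytic_quad[l [K [d [K0 d0 H]]]].
apply/nbhs_normcP; exists (d / 2); first by rewrite divr_gt0.
move=> z zw; suff h : is_cderive z g (l z) by rewrite (is_cderive_derive1 h).
have d2 : 0 < d / 2 by rewrite divr_gt0.
apply: (is_cderive_quad d2) => y yz; apply: H; first by lra.
rewrite (_ : y - w = (y - z) + (z - w)); last by ring.
by apply: le_lt_trans (le_normcD _ _) _; lra.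
Qed.

Lemma analytic_is_cderive g w : analytic_at g w -> is_cderive w g (g^`()%classic w).
Proof. by move=> /analytic_is_cderive_near/nbhs_singleton. Qed.

Lemma analytic_continuous g w : analytic_at g w -> fmap g (nbhs w) --> g w.
Proof. by move=> /analytic_is_cderive/is_cderive_continuous. Qed.

(* Comparing the three increments between w, z and 2z - w bounds
   |g' z - g' w| by 6K|z - w|. *)
Lemma analytic_derive_continuous g w : analytic_at g w ->
  fmap (g^`()%classic) (nbhs w) --> g^`()%classic w.
Proof.
move=> /[dup] /analytic_is_cderive_near gd /analytic_quad[l [K [d [K0 d0 H]]]].
have lE z : normc (z - w) < d / 2 -> g^`()%classic z = l z.
  move=> zw; apply: is_cderive_derive1.
  have d2 : 0 < d / 2 by rewrite divr_gt0.
  apply: (is_cderive_quad d2) => y yz; apply: H; first by lra.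
  rewrite (_ : y - w = (y - z) + (z - w)); last by ring.
  by apply: le_lt_trans (le_normcD _ _) _; lra.
have ww : normc (w - w) = 0 by rewrite subrr normc0.
rewrite lE ?ww ?divr_gt0//.
apply: (@cvgC_lip_normc _ _ _ _ _ _ (fun z => z) w (6 * K)); first exact: cvg_id.
apply/nbhs_normcP; exists (d / 2); first by rewrite divr_gt0.
move=> z zw; rewrite lE// normc_distC.
have [->|zw0] := eqVneq z w; first by rewrite !subrr normc0 mulr0.
have n0 : 0 < normc (z - w) by rewrite normc_gt0 subr_eq0.
pose y := z + (z - w).
have yz : y - z = z - w by rewrite /y addrAC subrr add0r.
have yw : y - w = (z - w) + (z - w) by rewrite /y; ring.
have ywn : normc (y - w) = 2 * normc (z - w).
  by rewrite yw -mulr2n normcMn mulr_natl.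
have zd : normc (z - w) < d by lra.
have yd : normc (y - w) < d by rewrite ywn; lra.
have wd : normc (w - w) < d by rewrite ww.
have h1 := H z y zd yd.
have h2 := H w y wd yd.
have h3 := H w z wd zd.
rewrite -(ler_pM2r n0) -normcM.
have -> : (l w - l z) * (z - w) = (g y - g z - l z * (y - z)) -
  (g y - g w - l w * (y - w)) + (g z - g w - l w * (z - w)).
  by rewrite yz yw; ring.
apply: le_trans (le_normcD _ _) _.
apply: le_trans (lerD (le_normcD _ _) (lexx _)) _; rewrite normcN.
apply: le_trans (lerD (lerD h1 h2) h3) _.
by rewrite ywn yz le_eqVlt; apply/orP; left; apply/eqP; ring.
Qed.

Lemma analytic_cst (k : R[i]) w : analytic_at (fun=> k) w.
Proof.
exists (fun n => if n is 0%N then k else 0).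
apply/nbhs_normcP; exists 1 => // z _.
apply: (@cvgC_lip _ _ _ _ _ _ (fun=> 0)); first exact: cvg_cst.
exists 1%N => //= n /= n0; rewrite /series /= big_ltn// expr0 mulr1.
rewrite big_nat_cond big1 ?addr0 ?subrr ?normc0//.
by move=> [|i]//= _; rewrite mul0r.
Qed.

Lemma analytic_id w : analytic_at (fun z => z) w.
Proof.
exists (fun n => if n is 0%N then w else if n is 1%N then 1 else 0).
apply/nbhs_normcP; exists 1 => // z _.
apply: (@cvgC_lip _ _ _ _ _ _ (fun=> 0)); first exact: cvg_cst.
exists 2%N => //= n /= n0; rewrite /series /= big_ltn 1?ltnW// big_ltn//.
rewrite expr0 mulr1 mul1r expr1 big_nat_cond big1 ?addr0; last first.
  by move=> [|[|i]]//= _; rewrite mul0r.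
rewrite (_ : w + (z - w) - z = 0) ?normc0; last by ring.
by [].
Qed.

Lemma analyticD f g w : analytic_at f w -> analytic_at g w ->
  analytic_at (fun z => f z + g z) w.
Proof.
move=> [a fa] [b gb]; exists (fun n => a n + b n).
have [d d0 dP] := nbhs_normcI fa gb.
apply/nbhs_normcP; exists d; [exact: d0|move=> z /dP[h1 h2]].
apply: (cvgC_eq _ (cvgCD h1 h2)) => n; rewrite /series /= -big_split /=.
by apply: eq_bigr => i _; rewrite mulrDl.
Qed.

Lemma analyticZ (k : R[i]) f w : analytic_at f w -> analytic_at (fun z => k * f z) w.
Proof.
move=> [a fa]; exists (fun n => k * a n).
have /nbhs_normcP[d d0 dP] := fa.
apply/nbhs_normcP; exists d; [exact: d0|move=> z /dP h1].
apply: (cvgC_eq _ (cvgCM (@cvgC_cst _ _ _ _ k) h1)) => n.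
by rewrite /series /= mulr_sumr; apply: eq_bigr => i _; rewrite mulrA.
Qed.

Lemma analytic_sum (I : Type) (s : seq I) (f : I -> R[i] -> R[i]) w :
  (forall i, analytic_at (f i) w) -> analytic_at (fun z => \sum_(i <- s) f i z) w.
Proof.
move=> fa; elim: s => [|i s IH].
  rewrite (_ : (fun z => _) = fun=> 0); first exact: analytic_cst.
  by apply/funext => z; rewrite big_nil.
rewrite (_ : (fun z => _) = fun z => f i z + \sum_(i <- s) f i z).
  exact: (analyticD (fa i) IH).
by apply/funext => z; rewrite big_cons.
Qed.

Lemma analytic_near f g w : (\forall z \near w, f z = g z) ->
  analytic_at f w -> analytic_at g w.
Proof.
move=> fg [c fc]; exists c; have [d d0 dP] := nbhs_normcI fg fc.
by apply/nbhs_normcP; exists d; [exact: d0|move=> z /dP[<-]].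
Qed.

End Analytic.

(** * Composition of analytic functions *)

Section PolyNorm.
Context {R : realType}.
Implicit Types (p q : {poly R[i]}) (rho : R).

(** The weighted l1 norm of the coefficients. It is submultiplicative and so controls powers of a
    polynomial without any formula for their coefficients. *)
Definition pnorm rho p := \sum_(k < size p) normc p`_k * rho ^+ k.

Lemma pnorm_wide rho p n : (size p <= n)%N ->
  pnorm rho p = \sum_(k < n) normc p`_k * rho ^+ k.
Proof.
move=> pn; rewrite /pnorm (big_ord_widen _ (fun k => normc p`_k * rho ^+ k) pn).
rewrite big_mkcond; apply: eq_bigr => k _; case: ltnP => // pk.
by rewrite nth_default// normc0 mul0r.
Qed.

Lemma pnorm_ge0 rho p : 0 <= rho -> 0 <= pnorm rho p.
Proof. by move=> r0; rewrite sumr_ge0// => k _; rewrite mulr_ge0 ?normc_ge0 ?exprn_ge0. Qed.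

Lemma pnorm_le rho rho' p : 0 <= rho <= rho' -> pnorm rho p <= pnorm rho' p.
Proof.
move=> /andP[r0 rr]; apply: ler_sum => k _; rewrite ler_wpM2l ?normc_ge0//.
by apply: lerXn2r; rewrite ?nnegrE// (le_trans r0).
Qed.

Lemma pnorm0 rho : pnorm rho 0 = 0.
Proof. by rewrite /pnorm size_poly0 big_ord0. Qed.

Lemma pnormD rho p q : 0 <= rho -> pnorm rho (p + q) <= pnorm rho p + pnorm rho q.
Proof.
move=> r0; pose n := maxn (size p) (size q).
rewrite !(@pnorm_wide _ _ n) ?size_polyD ?leq_maxl ?leq_maxr//.
rewrite -big_split /=; apply: ler_sum => k _.
by rewrite coefD -mulrDl ler_wpM2r ?exprn_ge0// le_normcD.
Qed.

Lemma pnormZ rho c p : pnorm rho (c *: p) = normc c * pnorm rho p.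
Proof.
rewrite (@pnorm_wide _ _ (size p)) ?size_scale_leq// /pnorm mulr_sumr.
by apply: eq_bigr => k _; rewrite coefZ normcM mulrA.
Qed.

Lemma pnorm_cons rho p c : pnorm rho (p * 'X + c%:P) = rho * pnorm rho p + normc c.
Proof.
rewrite (@pnorm_wide _ _ (size p).+1); last first.
  by rewrite -cons_poly_def size_cons_poly; case: ifP.
rewrite big_ord_recl /= coefD coefMX coefC /= add0r expr0 mulr1 addrC; congr (_ + _).
rewrite /pnorm mulr_sumr; apply: eq_bigr => k _.
by rewrite coefD coefMX coefC /= addr0 /bump /= add1n exprS mulrCA.
Qed.

Lemma pnormM rho p q : 0 <= rho -> pnorm rho (p * q) <= pnorm rho p * pnorm rho q.
Proof.
move=> r0; elim/poly_ind: p => [|p c IH]; first by rewrite mul0r pnorm0 mul0r.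
rewrite pnorm_cons [leRHS]mulrDl.
rewrite (_ : (p * 'X + c%:P) * q = (p * q * 'X + 0%:P) + c *: q); last first.
  by rewrite -mul_polyC polyC0 addr0; ring.
apply: le_trans (pnormD _ _ r0) _; rewrite pnorm_cons pnormZ normc0 addr0.
by rewrite lerD2r -mulrA ler_wpM2l.
Qed.

Lemma pnormX rho p n : 0 <= rho -> pnorm rho (p ^+ n) <= pnorm rho p ^+ n.
Proof.
move=> r0; elim: n => [|n IH].
  rewrite !expr0 -polyC1 -[_%:P]add0r -(mul0r 'X) pnorm_cons pnorm0.
  by rewrite mulr0 add0r normc1.
rewrite !exprS; apply: le_trans (pnormM _ _ r0) _.
by rewrite ler_wpM2l// pnorm_ge0.
Qed.

Lemma truncation_le rho p (z : R[i]) m : normc z <= rho ->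
  normc (\sum_(0 <= k < m) p`_k * z ^+ k) <= pnorm rho p.
Proof.
move=> zr; have r0 := le_trans (normc_ge0 z) zr.
rewrite (@pnorm_wide _ _ (m + size p)) ?leq_addl//.
rewrite -(big_mkord xpredT (fun k => normc p`_k * rho ^+ k)).
rewrite (big_cat_nat (leq0n m) (leq_addr _ _)) /= ler_wpDr//.
  by rewrite sumr_ge0// => k _; rewrite mulr_ge0 ?normc_ge0 ?exprn_ge0.
apply: le_trans (normc_sum _ _ _) _; apply: ler_sum => k _.
rewrite normcM normcX ler_wpM2l ?normc_ge0//.
by apply: lerXn2r; rewrite ?nnegrE ?normc_ge0.
Qed.

(** From degree m on, each term at radius rho is at most 2^-m times the same term at radius 2
    rho. *)
Lemma truncation_err rho p (z : R[i]) m : normc z <= rho ->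
  normc (p.[z] - \sum_(0 <= k < m) p`_k * z ^+ k) <= 2^-1 ^+ m * pnorm (2 * rho) p.
Proof.
move=> zr; have r0 := le_trans (normc_ge0 z) zr.
rewrite (horner_coef_wide z (leq_addl m (size p))).
rewrite (@pnorm_wide _ _ (m + size p)) ?leq_addl//.
rewrite -(big_mkord xpredT (fun k => normc p`_k * (2 * rho) ^+ k)).
rewrite -(big_mkord xpredT (fun k => p`_k * z ^+ k)).
rewrite !(big_cat_nat (leq0n m) (leq_addr (size p) m)) /= addrAC subrr add0r.
rewrite mulrDr ler_wpDl//.
  rewrite mulr_ge0 ?exprn_ge0// sumr_ge0// => k _.
  by rewrite mulr_ge0 ?normc_ge0 ?exprn_ge0 ?mulr_ge0.
apply: le_trans (normc_sum _ _ _) _; rewrite mulr_sumr ler_sum_nat// => k /andP[mk _].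
rewrite normcM normcX mulrCA ler_wpM2l ?normc_ge0//.
apply: le_trans (_ : rho ^+ k <= _).
  by apply: lerXn2r; rewrite ?nnegrE ?normc_ge0.
rewrite exprMn mulrA ler_peMl ?exprn_ge0// -(subnKC mk) exprD mulrA -exprMn.
by rewrite mulVf// expr1n mul1r exprn_ege1// ler1n.
Qed.

End PolyNorm.

Section Composition.
Context {R : realType}.
Implicit Types (z w : R[i]) (p q : {poly R[i]}).

(** Makes the coefficients of a composed series independent of the degree at which the inner series
    is truncated. *)
Lemma coef_exp_eq p q n k : (forall i, (i <= k)%N -> p`_i = q`_i) ->
  (p ^+ n)`_k = (q ^+ n)`_k.
Proof.
elim: n k => [|n IH] k pq; first by rewrite !expr0.
rewrite !exprS !coefM; apply: eq_bigr => i _; rewrite pq -1?ltnS//.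
by rewrite (IH (k - i)%N)// => j jk; apply: pq; apply: leq_trans jk (leq_subr _ _).
Qed.

(** A power p^n without constant term in p starts at degree n, so only the powers n <= k contribute
    to degree k of a composed series. *)
Lemma coef_exp_small p n k : p`_0 = 0 -> (k < n)%N -> (p ^+ n)`_k = 0.
Proof.
move=> p0; elim: n k => [//|n IH] k kn; rewrite exprS coefM big1// => -[[|i] ik] _ /=.
  by rewrite p0 mul0r.
rewrite IH ?mulr0// ltn_subLR//.
by rewrite addSn (leq_trans kn)// ltnS leq_addl.
Qed.

(** The inner series is replaced by its truncations [A m]; [pnorm] bounds their powers uniformly in
    m, and [tannery] passes to the limit. *)
Lemma power_series_comp (a b : nat -> R[i]) (C M C' M' : R) z (h s : R[i]) :
  0 < C -> 0 < M -> 0 < C' -> 0 < M' -> a 0%N = 0 ->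
  (forall n, normc (a n) <= C * M ^+ n) -> (forall n, normc (b n) <= C' * M' ^+ n) ->
  normc z * M <= 4^-1 -> 8 * C * M * normc z * M' <= 2^-1 ->
  fmap (series (fun n => a n * z ^+ n)) \oo --> h ->
  fmap (series (fun n => b n * h ^+ n)) \oo --> s ->
  fmap (series (fun k => (\sum_(0 <= n < k.+1)
      b n * ((\poly_(i < k.+1) a i) ^+ n)`_k) * z ^+ k)) \oo --> s.
Proof.
move=> C0 M0 C'0 M'0 a0 aC bC zM sM ah bs.
pose A m := \poly_(i < m) a i.
pose rho := normc z; have r0 : 0 <= rho := normc_ge0 z.
(* Since a 0 = 0, the norm of [A m] at radius 2 rho carries a factor rho; summing 4 C M rho 2^-k
   gives this bound, which is small for small z. *)
pose S := 8 * C * M * rho.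
have S0 : 0 <= S by rewrite !mulr_ge0// ltW.
have q01 : 0 <= (2^-1 : R) <= 2^-1 by rewrite lexx invr_ge0 ler0n.
have Anorm m : pnorm (2 * rho) (A m) <= S.
  rewrite (@pnorm_wide _ _ _ m) ?size_poly//.
  rewrite -(big_mkord xpredT (fun k => normc (A m)`_k * (2 * rho) ^+ k)).
  apply: le_trans (_ : \sum_(0 <= k < m) (4 * C * M * rho) * 2^-1 ^+ k <= _).
    apply: ler_sum_nat => k /andP[_ km]; rewrite coef_poly km.
    have q0 : 0 <= 4 * C * M * rho by rewrite !mulr_ge0// ltW.
    case: k km => [|k] km; first by rewrite a0 normc0 mul0r expr0 mulr1.
    apply: le_trans (_ : C * M ^+ k.+1 * (2 * rho) ^+ k.+1 <= _).
      by rewrite ler_wpM2r ?aC ?exprn_ge0 ?mulr_ge0.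
    rewrite -mulrA -exprMn exprS.
    have : (M * (2 * rho)) ^+ k <= 2^-1 ^+ k.
      apply: lerXn2r; rewrite ?nnegrE ?invr_ge0 ?mulr_ge0 ?(ltW M0)//.
      by move: zM; rewrite -/rho; lra.
    rewrite [2^-1 ^+ k.+1]exprS; set x := _ ^+ k; set y := _ ^+ k => xy.
    rewrite [leLHS](_ : _ = 2 * C * M * rho * x); last by ring.
    rewrite [leRHS](_ : _ = 2 * C * M * rho * y); last by field.
    by rewrite ler_wpM2l// !mulr_ge0// ltW.
  have q0 : 0 <= 4 * C * M * rho by rewrite !mulr_ge0// ltW.
  rewrite -mulr_sumr; have := ler_wpM2l q0 (sum_geometric_le 0 m q01).
  move=> /le_trans; apply.
  by rewrite expr0 /S le_eqVlt; apply/orP; left; apply/eqP; ring.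
have AXnorm m n : pnorm (2 * rho) (A m ^+ n) <= S ^+ n.
  have r2 : 0 <= 2 * rho by rewrite mulr_ge0.
  apply: le_trans (pnormX _ _ r2) _.
  by apply: lerXn2r; rewrite ?nnegrE ?pnorm_ge0.
(* Row m truncates the inner series and its powers at degree m. After exchanging sums, the sum over
   n < m is exactly the m-th partial sum of the composed series. *)
pose u m n := b n * \sum_(0 <= k < m) (A m ^+ n)`_k * z ^+ k.
have uC m n : normc (u m n) <= C' * 2^-1 ^+ n.
  rewrite /u normcM; apply: le_trans (_ : (C' * M' ^+ n) * S ^+ n <= _).
    apply: ler_pM; rewrite ?normc_ge0//.
    apply: le_trans (truncation_le _ _ (lexx rho)) _.
    apply: le_trans (AXnorm m n); apply: pnorm_le; rewrite r0 /=; lra.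
  rewrite -mulrA -exprMn ler_wpM2l ?(ltW C'0)//.
  have sM' : M' * S <= 2^-1 by rewrite mulrC.
  by apply: lerXn2r; rewrite ?nnegrE ?invr_ge0// mulr_ge0// ltW.
have Ah : fmap (fun m => (A m).[z]) \oo --> h.
  by apply: (cvgC_eq _ ah) => m; rewrite horner_poly /series /= big_mkord.
have uv n : fmap (u ^~ n) \oo --> b n * h ^+ n.
  apply: cvgCM; first exact: cvgC_cst.
  have h1 : fmap (fun m => (A m ^+ n).[z]) \oo --> h ^+ n.
    by apply: (cvgC_eq _ (cvgCX Ah)) => m; rewrite horner_exp.
  have h2 : fmap (fun m => (A m ^+ n).[z] -
      \sum_(0 <= k < m) (A m ^+ n)`_k * z ^+ k) \oo --> (0 : R[i]).
    apply: (@cvgC_lip _ _ _ _ _ _ (fun m => 2^-1 ^+ m * S ^+ n)).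
      rewrite -(mul0r (S ^+ n)); apply: cvgM; last exact: cvg_cst.
      by apply: cvg_expr; rewrite ger0_norm ?invr_ge0// invf_lt1// ltr1n.
    apply: nearW => m; rewrite subr0; apply: le_trans (truncation_err _ _ (lexx rho)) _.
    by rewrite ler_wpM2l// exprn_ge0// invr_ge0.
  rewrite -[h ^+ n]subr0; apply: (cvgC_eq _ (cvgCB h1 h2)) => m.
  by rewrite opprB addrC subrK.
apply: (cvgC_eq _ (tannery (ltW C'0) q01 uC uv bs)) => m; rewrite /series /= /u.
under eq_bigr do rewrite mulr_sumr.
rewrite exchange_big_nat /=; apply: eq_big_nat => k /andP[_ km].
rewrite mulr_suml (big_cat_nat (leq0n k.+1) km) /= [X in _ + X]big_nat_cond.
rewrite [X in _ + X]big1 ?addr0; last first.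
  move=> n /andP[/andP[kn _] _]; rewrite coef_exp_small ?mul0r ?mulr0//.
  by rewrite coef_poly a0 if_same.
apply: eq_bigr => n _; rewrite mulrA; congr (_ * _ * _).
apply: coef_exp_eq => i ik; rewrite !coef_poly ltnS ik.
by rewrite (leq_ltn_trans ik km).
Qed.

Lemma analytic_comp (g h : R[i] -> R[i]) w : analytic_at h w -> analytic_at g (h w) ->
  analytic_at (fun z => g (h z)) w.
Proof.
move=> /analytic_at_power_series[a [C [M hP']]].
move=> /analytic_at_power_series[b [C' [M' [C'0 M'0 bC gP]]]].
have aw := power_series_center hP'; have [C0 M0 aC hP] := hP'.
(* Without its constant term the inner series sums to h z - h w, the increment in which g is
   expanded at h w. *)
pose a' n := if n is 0%N then 0 else a n.
exists (fun k => \sum_(0 <= n < k.+1) b n * ((\poly_(i < k.+1) a' i) ^+ n)`_k).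
have M8 : 0 < (8 * M)^-1 by rewrite invr_gt0 mulr_gt0.
have CM8 : 0 < (64 * C * M * M')^-1 by rewrite invr_gt0 !mulr_gt0.
(* The second radius makes 8 C M |z - w| M' at most 1/8. This serves both the substitution and the
   convergence of the outer series, because |h z - h w| <= 4 C M |z - w|. *)
apply/nbhs_normcP; exists (Num.min (8 * M)^-1 (64 * C * M * M')^-1).
  by rewrite lt_min M8 CM8.
move=> z; rewrite lt_min => /andP[z1 z2].
have zM : normc (z - w) * M <= 8^-1.
  by rewrite -ler_pdivlMr// -invfM ltW.
have zM' : 8 * C * M * normc (z - w) * M' <= 8^-1.
  rewrite (_ : _ * M' = normc (z - w) * (64 * C * M * M') * 8^-1); last by field.
  rewrite ler_piMl// -ler_pdivlMr ?mulr_gt0// mul1r; exact: ltW.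
have a'C n : normc (a' n) <= C * M ^+ n.
  case: n => [|n]; last exact: aC.
  by rewrite normc0 mulr_ge0 ?exprn_ge0 ?(ltW C0, ltW M0).
have a'h : fmap (series (fun n => a' n * (z - w) ^+ n)) \oo --> h z - h w.
  apply: (cvgC_near_eq _ (cvgCB (hP z zM) (@cvgC_cst _ _ _ _ (h w)))).
  exists 1%N => //= n /= n0.
  rewrite /series /= !(big_ltn n0) !expr0 !mulr1 add0r -aw addrAC subrr add0r.
  by apply: eq_big_nat => -[|k] // /andP[].
have hd : normc (h z - h w) * M' <= 8^-1.
  have q01 : 0 <= (2^-1 : R) <= 2^-1 by rewrite lexx invr_ge0 ler0n.
  have cM0 : 0 <= 2 * C * M * normc (z - w).
    by rewrite !mulr_ge0 ?normc_ge0// ltW.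
  have : normc (h z - h w) <= 2 * (2 * C * M * normc (z - w)).
    apply: (series_dominated_le cM0 q01 _ a'h) => -[|k].
      by rewrite mul0r normc0 expr0 mulr1.
    rewrite normcM normcX.
    apply: le_trans (_ : C * M ^+ k.+1 * normc (z - w) ^+ k.+1 <= _).
      by rewrite ler_wpM2r ?exprn_ge0 ?normc_ge0.
    rewrite -mulrA -exprMn !exprS.
    have : (M * normc (z - w)) ^+ k <= 2^-1 ^+ k.
      apply: lerXn2r; rewrite ?nnegrE ?invr_ge0 ?mulr_ge0 ?normc_ge0 ?(ltW M0)//.
      by lra.
    set x := _ ^+ k; set y := _ ^+ k => xy.
    rewrite [leLHS](_ : _ = C * M * normc (z - w) * x); last by ring.
    rewrite [leRHS](_ : _ = C * M * normc (z - w) * y); last by field.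
    by rewrite ler_wpM2l// !mulr_ge0 ?normc_ge0// ltW.
  move=> /(ler_wpM2r (ltW M'0))/le_trans; apply.
  apply: le_trans zM'; rewrite ler_wpM2r ?(ltW M'0)//.
  have := mulr_ge0 (mulr_ge0 (ltW C0) (ltW M0)) (normc_ge0 (z - w)); lra.
apply: (power_series_comp C0 M0 C'0 M'0 erefl a'C bC _ _ a'h (gP _ hd)) => //.
  by lra.
by lra.
Qed.

End Composition.

(** * The complex exponential *)

Section Exponential.
Context {R : realType}.
Implicit Types (z w : R[i]) (x y t : R).

Lemma expC0 : expC 0 = 1 :> R[i].
Proof. by rewrite /expC /= expR0 cos0 sin0 mul1r. Qed.

Lemma expCD z w : expC (z + w) = expC z * expC w.
Proof.
case: z w => [a b] [c d]; rewrite /expC /= expRD cosD sinD.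
apply/eqP; rewrite eq_complex /= !mul0r !subr0 !addr0.
by apply/andP; split; apply/eqP; ring.
Qed.

Lemma normc_expC z : normc (expC z) = expR (complex.Re z).
Proof.
rewrite /expC normcM normc_real ger0_norm ?expR_ge0//.
by rewrite /= cos2Dsin2 sqrtr1 mulr1.
Qed.

Lemma expC_neq0 z : expC z != 0.
Proof. by rewrite -normc_gt0 normc_expC expR_gt0. Qed.

Lemma expCN z : expC (- z) = (expC z)^-1.
Proof.
by apply: (mulIf (expC_neq0 z)); rewrite -expCD addNr expC0 mulVf ?expC_neq0.
Qed.

Lemma expR_partial_sum_le x m : 0 <= x ->
  \sum_(0 <= k < m) x ^+ k / k`!%:R <= expR x.
Proof.
move=> x0; apply: (@nondecreasing_cvgn_le R (series (exp_coeff x))).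
  apply/nondecreasing_seqP => n.
  by rewrite /series /= big_nat_recr//= lerDl exp_coeff_ge0.
exact: is_cvg_series_exp_coeff.
Qed.

Lemma exp_series_real x :
  fmap (series (fun n => (x%:C) ^+ n / n`!%:R)) \oo --> (expR x)%:C.
Proof.
apply: (cvgC_eq _ (cvg_real (is_cvg_series_exp_coeff x))) => n.
rewrite /series /= rmorph_sum; apply: eq_bigr => k _.
by rewrite /exp_coeff /= fmorph_div rmorphXn rmorph_nat.
Qed.

Lemma expi_powE y k : ('i * y%:C) ^+ k / k`!%:R = cos_coeff y k +i* sin_coeff y k :> R[i].
Proof.
have ik : 'i ^+ k = (-1) ^+ k./2 * (if odd k then 'i else 1) :> R[i].
  rewrite -{1}(odd_double_half k) exprD -mul2n exprM sqr_i mulrC.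
  by case: odd.
have kE : (k`!%:R : R[i]) = (k`!%:R)%:C by rewrite rmorph_nat.
have sE : ((-1) ^+ k./2 : R[i]) = ((-1) ^+ k./2)%:C by rewrite rmorphXn rmorphN1.
rewrite exprMn ik -rmorphXn sE kE -fmorphV /cos_coeff /sin_coeff.
apply/eqP; rewrite eq_complex; case: ifPn => ok; last first.
  rewrite /= (negbTE ok) -!exprnP /=.
  move: (k.-1./2) ((-1) ^+ k./2) (y ^+ k) (k`!%:R^-1) => j e p q.
  by apply/andP; split; apply/eqP; rewrite /=; ring.
(* [sin_coeff] halves k - 1 while the power of i halves k; the two agree for odd k. *)
rewrite /=; have -> : k.-1./2 = k./2.
  by case: k ok {ik kE sE} => //= k; rewrite uphalf_half => /negbTE ->.
rewrite ok -?exprnP /=.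
move: ((-1) ^+ k./2) (y ^+ k) (k`!%:R^-1) => e p q.
by apply/andP; split; apply/eqP; rewrite /=; ring.
Qed.

Lemma exp_series_imag y :
  fmap (series (fun n => ('i * y%:C) ^+ n / n`!%:R)) \oo --> cos y +i* sin y.
Proof.
have E n : series (fun n => ('i * y%:C) ^+ n / n`!%:R) n =
    series (cos_coeff y) n +i* series (sin_coeff y) n :> R[i].
  rewrite /series /=; under eq_bigr do rewrite expi_powE.
  apply/eqP; rewrite eq_complex raddf_sum /= raddf_sum /=.
  by apply/andP; split.
apply: cvgC_ReIm.
  under eq_fun do rewrite E.
  by rewrite cos.unlock; exact: is_cvg_series_cos_coeff.
under eq_fun do rewrite E.
by rewrite sin.unlock; exact: is_cvg_series_sin_coeff.
Qed.

Lemma pnorm_exp_le (u : R[i]) m :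
  pnorm 2 (\poly_(k < m) (u ^+ k / k`!%:R)) <= expR (2 * normc u).
Proof.
rewrite (@pnorm_wide _ _ _ m) ?size_poly//.
apply: le_trans (expR_partial_sum_le m _); last by rewrite mulr_ge0 ?normc_ge0.
rewrite big_mkord; apply: ler_sum => k _; rewrite coef_poly ltn_ord.
by rewrite normcM normcX normcV normc_nat exprMn mulrC mulrA.
Qed.

(** Cauchy product through polynomials evaluated at 1: below degree m the product of the two
    truncated exponentials has the binomial coefficients of u + v, and [truncation_err] removes the
    rest. *)
Lemma exp_seriesD (u v su sv : R[i]) :
  fmap (series (fun n => u ^+ n / n`!%:R)) \oo --> su ->
  fmap (series (fun n => v ^+ n / n`!%:R)) \oo --> sv ->
  fmap (series (fun n => (u + v) ^+ n / n`!%:R)) \oo --> su * sv.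
Proof.
move=> hu hv.
pose P (w : R[i]) m := \poly_(k < m) (w ^+ k / k`!%:R).
have PE w m : (P w m).[1] = series (fun n => w ^+ n / n`!%:R) m.
  rewrite horner_poly /series /= big_mkord.
  by apply: eq_bigr => k _; rewrite expr1n mulr1.
have trunc m : \sum_(0 <= k < m) (P u m * P v m)`_k * 1 ^+ k =
    series (fun n => (u + v) ^+ n / n`!%:R) m.
  rewrite /series /=; apply: eq_big_nat => k /andP[_ km].
  rewrite expr1n mulr1 [u + v]addrC exprDn coefM mulr_suml.
  apply: eq_bigr => i _; have ik : (i <= k)%N by rewrite -ltnS.
  rewrite !coef_poly (leq_ltn_trans ik km) (leq_ltn_trans (leq_subr _ _) km).
  have nz n : n`!%:R != 0 :> R[i] by rewrite pnatr_eq0 -lt0n fact_gt0.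
  rewrite -mulr_natr -(bin_fact ik) !natrM.
  have bz : 'C(k, i)%:R != 0 :> R[i] by rewrite pnatr_eq0 -lt0n bin_gt0.
  by field; rewrite bz !nz.
have h0 : fmap (fun m => (P u m * P v m).[1] -
    \sum_(0 <= k < m) (P u m * P v m)`_k * 1 ^+ k) \oo --> (0 : R[i]).
  apply: (@cvgC_lip _ _ _ _ _ _
    (fun m => 2^-1 ^+ m * (expR (2 * normc u) * expR (2 * normc v)))).
    rewrite -(mul0r (expR (2 * normc u) * expR (2 * normc v))).
    apply: cvgM; last exact: cvg_cst.
    by apply: cvg_expr; rewrite ger0_norm ?invr_ge0// invf_lt1// ltr1n.
  apply: nearW => m; rewrite subr0.
  have n1 : normc (1 : R[i]) <= 1 by rewrite normc1.
  apply: le_trans (truncation_err _ _ n1) _.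
  rewrite ler_wpM2l ?exprn_ge0 ?invr_ge0// mulr1.
  apply: le_trans (pnormM _ _ (ler0n _ _)) _.
  by apply: ler_pM; rewrite ?pnorm_ge0// pnorm_exp_le.
rewrite -[su * sv]subr0.
apply: (cvgC_eq _ (cvgCB (cvgCM hu hv) h0)) => m.
by rewrite hornerM !PE opprB addrC subrK trunc.
Qed.

Lemma exp_series z : fmap (series (fun n => n`!%:R^-1 * z ^+ n)) \oo --> expC z.
Proof.
have := exp_seriesD (@exp_series_real (complex.Re z)) (@exp_series_imag (complex.Im z)).
by rewrite -complexE; apply: cvgC_eq => n; apply: eq_bigr => k _; rewrite mulrC.
Qed.

Lemma power_series_expC : power_series_at (@expC R) 0 (fun n => n`!%:R^-1) 1 1.
Proof.
split => // [n|z _]; last by rewrite subr0; exact: exp_series.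
by rewrite expr1n mulr1 normcV normc_nat invf_le1 ?ltr0n ?fact_gt0// ler1n fact_gt0.
Qed.

(** The addition formula transports the expansion at 0 to w. *)
Lemma analytic_expC w : analytic_at (@expC R) w.
Proof.
have e0 : analytic_at (@expC R) (w + - w).
  rewrite subrr; exists (fun n => n`!%:R^-1).
  apply/nbhs_normcP; exists 1 => // z _; rewrite subr0; exact: exp_series.
have := analyticZ (expC w) (analytic_comp
  (analyticD (analytic_id w) (analytic_cst (- w) w)) e0).
apply: analytic_near; apply/nbhs_normcP; exists 1 => // z _.
by rewrite -expCD addrC subrK.
Qed.

Lemma is_cderive_expC w : is_cderive w (@expC R) (expC w).
Proof.
have e0 := power_series_is_cderive power_series_expC.
rewrite invr1 in e0.
have h : is_cderive w (fun z => z - w) 1.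
  by have := is_cderiveB (is_cderive_id w) (is_cderive_cst w w); rewrite subr0.
have e1 : is_cderive (w - w) (@expC R) 1 by rewrite subrr.
have := is_cderiveZ (expC w) (is_cderive_comp h e1); rewrite !mulr1.
apply: is_cderive_near; apply/nbhs_normcP; exists 1 => // z _.
by rewrite -expCD addrC subrK.
Qed.

Lemma lnC_expC (s : R[i]) : `|complex.Im s| < pi -> lnC (expC s) = s.
Proof.
case: s => x y /=; rewrite ltr_norml => /andP[y1 y2].
rewrite /lnC normc_expC /= expRK /argC normc_expC /expC /=.
rewrite !mul0r subr0 addr0; congr (_ +i* _).
rewrite [expR x * cos y]mulrC mulfK ?expR_eq0//.
rewrite pmulr_rge0 ?expR_gt0//.
have [y0|y0] := leP 0 y.
  by rewrite sin_ge0_pi ?y0 ?(ltW y2)// cosK// in_itv /= y0 ltW.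
have : 0 < sin (- y) by rewrite sin_gt0_pi// oppr_gt0 y0 ltrNl.
rewrite sinN oppr_gt0 ltNge => /negbTE ->.
by rewrite cosKN ?opprK// (ltW y1) (ltW y0).
Qed.

End Exponential.

(** * The principal logarithm *)

Section Logarithm.
Context {R : realType}.
Implicit Types (z w h : R[i]).

(* At n = 0 the junk value 0^-1 = 0 gives the constant coefficient 0. *)
Let log_coef n : R[i] := (-1) ^+ n.+1 / n%:R.

Let log_coef_le n : normc (log_coef n) <= 1 * 1 ^+ n.
Proof.
rewrite expr1n mulr1 normcM normcX normcV normc_nat normcN normc1 expr1n mul1r.
by case: n => [|n]; rewrite ?invr0// invf_le1 ?ltr0n// ler1n.
Qed.

Let log_term_le h n : normc h <= 8^-1 -> normc (log_coef n * h ^+ n) <= 4^-1 * 2^-1 ^+ n.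
Proof.
move=> h8; have := log_coef_le n; rewrite expr1n mulr1 => cn.
case: n cn => [|n] cn.
  by rewrite /log_coef invr0 mulr0 mul0r normc0 expr0 mulr1 invr_ge0.
rewrite normcM normcX; apply: le_trans (_ : 1 * 8^-1 ^+ n.+1 <= _).
  apply: ler_pM; rewrite ?normc_ge0 ?exprn_ge0 ?normc_ge0//.
  by apply: lerXn2r; rewrite ?nnegrE ?normc_ge0 ?invr_ge0.
rewrite mul1r (_ : 8^-1 = 4^-1 * 2^-1 :> R); last by field.
rewrite exprMn ler_wpM2r ?exprn_ge0 ?invr_ge0//.
rewrite exprS ler_piMr ?invr_ge0//; apply: exprn_ile1; first by rewrite invr_ge0.
by rewrite invf_le1// ler1n.
Qed.

Let half01 : 0 <= (2^-1 : R) <= 2^-1.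
Proof. by rewrite lexx invr_ge0 ler0n. Qed.

Let log_sum_ex h : exists s : R[i], normc h <= 8^-1 ->
  fmap (series (fun n => log_coef n * h ^+ n)) \oo --> s.
Proof.
have [h8|] := boolP (normc h <= 8^-1); last by exists 0.
have a0 : 0 <= (4^-1 : R) by rewrite invr_ge0.
by have [s sP] := series_dominated_cvg a0 half01 (fun k => log_term_le k h8); exists s.
Qed.

Let log_sum h : R[i] := projT1 (cid (log_sum_ex h)).

Let power_series_log_sum : power_series_at log_sum 0 log_coef 1 1.
Proof.
split => // z; rewrite mulr1 subr0 => z8.
exact: (projT2 (cid (log_sum_ex z)) z8).
Qed.

(** The value 1/2 matters for branches: two such logarithms together have imaginary part at most 1 <
    pi, so sums and differences stay in the range where [lnC] inverts [expC]. *)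
Let log_sum_small h : normc h <= 8^-1 -> normc (log_sum h) <= 2^-1.
Proof.
move=> h8; have a0 : 0 <= (4^-1 : R) by rewrite invr_ge0.
have := series_dominated_le a0 half01 (fun k => log_term_le k h8)
  (projT2 (cid (log_sum_ex h)) h8).
by rewrite (_ : 2 * 4^-1 = 2^-1 :> R)//; field.
Qed.

Let one_add_neq0 h : normc h < 8^-1 -> 1 + h != 0.
Proof.
apply: contraTneq => /eqP; rewrite addrC addr_eq0 => /eqP ->.
by rewrite normcN normc1 -leNgt invf_le1// ler1n.
Qed.

(** The derived series is the geometric series in - h, whose partial sums are explicit. *)
Let is_cderive_log_sum h : normc h < 8^-1 -> is_cderive h log_sum (1 + h)^-1.
Proof.
move=> h8; have d0 : 0 < 8^-1 - normc h by rewrite subr_gt0.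
apply: (is_cderive_quad d0) => y yh.
apply: (power_series_quad power_series_log_sum).
- by rewrite subr0 mulr1 ltW.
(* The factor 2 absorbs an index shift: n + 1 terms of the derived series leave an error with the
   n-th power of h. *)
- apply: (@cvgC_lip _ _ _ _ _ _ (fun n => normc (1 + h)^-1 * 2 * 2^-1 ^+ n)).
    rewrite -(mulr0 (normc (1 + h)^-1 * 2)); apply: cvgM; first exact: cvg_cst.
    by apply: cvg_expr; rewrite ger0_norm ?invr_ge0// invf_lt1// ltr1n.
  exists 1%N => // -[//|n] _ /=; rewrite subr0.
  have -> : series (fun n => n%:R * log_coef n * h ^+ n.-1) n.+1 =
      (1 - (- h) ^+ n) / (1 + h).
    apply: (mulIf (one_add_neq0 h8)); rewrite mulfVK ?one_add_neq0//.
    rewrite /series /= big_nat_recl// !mul0r add0r.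
    have := subrX1 (- h) n; rewrite -opprB => /(congr1 -%R); rewrite opprK => ->.
    rewrite -mulNr opprB opprK mulrC big_mkord; congr (_ * _).
    apply: eq_bigr => k _; rewrite /log_coef /= mulrCA mulfV ?pnatr_eq0// mulr1.
    by rewrite -[- h]mulN1r exprMn !exprS !mulN1r opprK.
  rewrite (_ : _ - _ = (1 + h)^-1 * (- (- h) ^+ n)); last by field; exact: one_add_neq0.
  rewrite normcM -mulrA ler_wpM2l ?normc_ge0// normcN normcX normcN exprS mulrA.
  rewrite mulfV// mul1r; apply: lerXn2r; rewrite ?nnegrE ?normc_ge0 ?invr_ge0//.
  by lra.
- rewrite subr0 mulr1 (_ : y = (y - h) + h); last by ring.
  by apply: le_trans (le_normcD _ _) _; lra.
Qed.

(* The derivative of [expC (- log_sum h) * (1 + h)] vanishes. *)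
Let expC_log_sum h : normc h < 8^-1 -> expC (log_sum h) = 1 + h.
Proof.
move=> h8.
have d z : normc z < 8^-1 -> is_cderive z (fun z => expC (- log_sum z) * (1 + z)) 0.
  move=> z8; have dS := is_cderiveN (is_cderive_log_sum z8).
  have := is_cderiveM (is_cderive_comp dS (is_cderive_expC _))
    (is_cderiveD (is_cderive_cst z 1) (is_cderive_id z)).
  rewrite add0r mulr1 mulrN mulrN mulrCA mulfV ?one_add_neq0// mulr1.
  by rewrite subrr.
have := is_cderive_cst_ball d h8.
rewrite (power_series_center power_series_log_sum) /log_coef invr0 mulr0 oppr0.
rewrite expC0 addr0 mulr1 expCN => /(congr1 ( *%R (expC (log_sum h)))).
by rewrite mulVKf ?expC_neq0// mulr1.
Qed.

Let lnC_log_sum h : normc h < 8^-1 -> lnC (1 + h) = log_sum h.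
Proof.
move=> h8; rewrite -(expC_log_sum h8) lnC_expC//.
apply: le_lt_trans (Im_le_normc _) _; apply: le_lt_trans (log_sum_small (ltW h8)) _.
by have := pi_ge2 R; lra.
Qed.

Lemma expC_lnC w : normc (w - 1) < 8^-1 -> expC (lnC w) = w.
Proof.
move=> w8; rewrite -{2}(subrK 1 w) addrC -(expC_log_sum w8).
by rewrite -(lnC_log_sum w8) [1 + _]addrC subrK.
Qed.

Lemma lnC_small w : normc (w - 1) < 8^-1 -> `|complex.Im (lnC w)| <= 2^-1.
Proof.
move=> w8; apply: le_trans (Im_le_normc _) _.
have := log_sum_small (ltW w8).
by rewrite -(lnC_log_sum w8) addrC subrK.
Qed.

Lemma lnCM a b : normc (a - 1) < 8^-1 -> normc (b - 1) < 8^-1 ->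
  lnC (a * b) = lnC a + lnC b :> R[i].
Proof.
move=> a8 b8; rewrite -{1}(expC_lnC a8) -{1}(expC_lnC b8) -expCD lnC_expC//.
rewrite raddfD /=; apply: le_lt_trans (ler_normD _ _) _.
apply: le_lt_trans (lerD (lnC_small a8) (lnC_small b8)) _.
by have := pi_ge2 R; lra.
Qed.

Lemma lnC_div a b : normc (a - 1) < 8^-1 -> normc (b - 1) < 8^-1 ->
  lnC (a / b) = lnC a - lnC b :> R[i].
Proof.
move=> a8 b8; rewrite -{1}(expC_lnC a8) -{1}(expC_lnC b8) -expCN -expCD lnC_expC//.
rewrite raddfB /=; apply: le_lt_trans (ler_normB _ _) _.
apply: le_lt_trans (lerD (lnC_small a8) (lnC_small b8)) _.
by have := pi_ge2 R; lra.
Qed.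

Lemma lnC1 : lnC 1 = 0 :> R[i].
Proof. by rewrite -{1}expC0 lnC_expC//= normr0 pi_gt0. Qed.

Lemma near1_neq0 w : normc (w - 1) < 8^-1 -> w != 0.
Proof. by move=> /one_add_neq0; rewrite addrC subrK. Qed.

Lemma near1_slit_plane w : normc (w - 1) < 8^-1 -> slit_plane w.
Proof.
move=> w8 [_ wr]; have := le_lt_trans (Re_le_normc _) w8.
rewrite raddfB /= => /ltr_normlW; have /ltr_normlP[] := le_lt_trans (Re_le_normc _) w8.
by rewrite raddfB /=; lra.
Qed.

Let lnC_log_sumE : \forall w \near (1 : R[i]), log_sum (w - 1) = lnC w.
Proof.
apply/nbhs_normcP; exists 8^-1; first by rewrite invr_gt0.
by move=> w /lnC_log_sum <-; rewrite addrC subrK.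
Qed.

Lemma is_cderive_lnC1 : is_cderive 1 (@lnC R) 1.
Proof.
apply: (is_cderive_near lnC_log_sumE).
have n0 : normc (0 : R[i]) < 8^-1 by rewrite normc0 invr_gt0.
have := is_cderive_log_sum n0; rewrite addr0 invr1 -(subrr 1) => h.
have h1 := is_cderiveB (is_cderive_id 1) (is_cderive_cst (1 : R[i]) 1).
by have := is_cderive_comp h1 h; rewrite subr0 mulr1.
Qed.

Let analytic_lnC1 : analytic_at (@lnC R) 1.
Proof.
apply: (analytic_near lnC_log_sumE).
apply: (analytic_comp (analyticD (analytic_id 1) (analytic_cst (-1) 1))).
rewrite subrr; exists log_coef.
apply/nbhs_normcP; exists 8^-1; first by rewrite invr_gt0.
have [_ _ _ H] := power_series_log_sum.
by move=> z z8; apply: H; rewrite mulr1 ltW.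
Qed.

(** Near w, lnC z = lnC w + lnC (z / w), which reduces the claim to the point 1. *)
Lemma analytic_lnC w : normc (w - 1) < 8^-1 -> analytic_at (@lnC R) w.
Proof.
move=> w8; have w0 := near1_neq0 w8.
have h1 : analytic_at (fun z => lnC w + lnC (w^-1 * z)) w.
  apply: analyticD; first exact: analytic_cst.
  apply: (analytic_comp (analyticZ w^-1 (analytic_id w))).
  by rewrite mulVf//; exact: analytic_lnC1.
apply: analytic_near h1; apply/nbhs_normcP.
have nw : 0 < normc w by rewrite normc_gt0.
exists (normc w / 8); first by rewrite divr_gt0.
move=> z zw; rewrite -lnCM ?mulVKf//.
rewrite (_ : _ - 1 = (z - w) / w); last by field.
by rewrite normcM normcV ltr_pdivrMr// mulrC.
Qed.

End Logarithm.

(** * Rotations by [expC ('i * theta)] and their real periods *)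

Section Rotation.
Context {R : realType}.
Implicit Types (z w : R[i]).

Lemma expC_i0 : expC ('i * 0) = 1 :> R[i].
Proof. by rewrite mulr0 expC0. Qed.

Lemma analytic_expCi w : analytic_at (fun u : R[i] => expC ('i * u)) w.
Proof. exact: (analytic_comp (analyticZ 'i (analytic_id w)) (analytic_expC _)). Qed.

Lemma is_cderive_expCi w :
  is_cderive w (fun u : R[i] => expC ('i * u)) (expC ('i * w) * 'i).
Proof.
have := is_cderive_comp (is_cderiveZ 'i (is_cderive_id w)) (is_cderive_expC _).
by rewrite mulr1.
Qed.

Lemma normc_expCi_le w : normc (expC ('i * w)) <= expR (normc w).
Proof.
rewrite normc_expC ler_expR; apply: le_trans (ler_norm _) _.
apply: le_trans (Re_le_normc _) _.
rewrite normcM (_ : normc 'i = 1) ?mul1r//.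
by rewrite /= expr0n expr1n add0r sqrtr1.
Qed.

Lemma normc_expCi_real (t : R) : normc (expC ('i * t%:C)) = 1.
Proof. by rewrite normc_expC /= mul0r mul1r subrr expR0. Qed.

Lemma cosDint (t : R) (k : int) : cos (t + k%:~R * (2 * pi)) = cos t.
Proof.
have P n (x : R) : cos (x + n%:R * (2 * pi)) = cos x.
  by rewrite mulr_natl mulr_natl periodicn//; exact: cosD2pi.
case: k => n; first exact: P.
by rewrite NegzE mulrNz -[in RHS](subrK (n.+1%:R * (2 * pi)) t) P mulNr.
Qed.

(** Reduce t to s in [0, 2 pi[. If s > 0 then sin (s / 2) > 0, contradicting cos s = 1 - 2 sin^2 (s
    / 2). *)
Lemma cos_eq1 (t : R) : cos t = 1 -> exists k : int, t = k%:~R * (2 * pi).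
Proof.
move=> ct; have p2 : 0 < 2 * pi :> R by rewrite mulr_gt0// pi_gt0.
pose k := Num.floor (t / (2 * pi)); exists k.
pose s := t - k%:~R * (2 * pi).
have s0 : 0 <= s by rewrite subr_ge0 -ler_pdivlMr// floor_le.
have s1 : s < 2 * pi.
  rewrite ltrBlDr -{1}(mul1r (2 * pi)) -mulrDl -ltr_pdivrMr//.
  by have := floorD1_gt (t / (2 * pi)); rewrite intrD [_ + 1%:~R]addrC.
have tE : t = s + k%:~R * (2 * pi) by rewrite subrK.
have cs : cos s = 1 by rewrite -ct tE cosDint.
have : s = 0.
  apply/eqP; rewrite eq_le s0 andbT leNgt; apply/negP => s_gt0.
  have : 0 < sin (s / 2).
    by apply: sin_gt0_pi; apply/andP; split; lra.
  have := cos_mulr2n (s / 2).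
  rewrite (_ : s / 2 *+ 2 = s) ?cs; last by rewrite -mulr_natr divfK.
  rewrite -mulr_natr => c2; have cs2 := cos2Dsin2 (s / 2).
  by move=> /(exprn_gt0 2); lra.
by move=> s00; rewrite {1}tE s00 add0r.
Qed.

Lemma expCi_real_eq1 (t : R) : expC ('i * t%:C) = 1 -> exists k : int, t = k%:~R * (2 * pi).
Proof.
rewrite /expC /= !mul0r !mul1r subrr add0r expR0 mul1r => -[ct _].
exact: cos_eq1.
Qed.

Lemma cvgC_comp (T : Type) (F : set_system T) {FF : Filter F} (u : T -> R[i])
    (g : R[i] -> R[i]) z : fmap u F --> z -> fmap g (nbhs z) --> g z ->
  fmap (fun x => g (u x)) F --> g z.
Proof. by move=> uz gz; exact: (cvg_comp _ _ uz gz). Qed.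

End Rotation.

(** * The function H *)

Section PhaseFunction.
Context {R : realType} (m : nat) (r : R) (f : 'I_m -> R[i] -> R[i]).
Hypothesis f_analytic : forall j z, disk r z -> analytic_at (f j) z.
Implicit Types (z w theta u : R[i]) (d : 'rV[R]_m.+1).

Local Notation e theta := (expC ('i * theta)).

(* The logarithms in [Hfun] are evaluated in the disk |w - 1| < 1/8, where
   [lnC] is given by its power series. *)
Definition good theta z :=
  [/\ disk r z, disk r (z * e theta), forall j, f j z != 0
    & forall j, normc (log_arg f j theta z - 1) < 8^-1].

Lemma good_H_defined theta z : good theta z -> H_defined r f theta z.
Proof. by move=> [h1 h2 h3 h4]; split => // j; split => //; exact: near1_slit_plane. Qed.

Section LogArgLimit.
Context {T : Type} {F : set_system T} {FF : Filter F}.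
Variables (th zz : T -> R[i]) (theta z : R[i]).
Hypotheses (th_lim : fmap th F --> theta) (zz_lim : fmap zz F --> z).

Lemma rotation_cvg : fmap (fun x => zz x * e (th x)) F --> z * e theta.
Proof.
apply: cvgCM; first exact: zz_lim.
exact: (cvgC_comp th_lim (analytic_continuous (analytic_expCi theta))).
Qed.

Lemma log_arg_cvg j : disk r z -> disk r (z * e theta) -> f j z != 0 ->
  fmap (fun x => log_arg f j (th x) (zz x)) F --> log_arg f j theta z.
Proof.
move=> zr zer fz; apply: cvgCM.
  exact: (cvgC_comp rotation_cvg (analytic_continuous (f_analytic j zer))).
apply: (@cvgCV _ _ _ _ (fun x => f j (zz x)) _ fz).
exact: (cvgC_comp zz_lim (analytic_continuous (f_analytic j zr))).
Qed.

Lemma Hfun_cvg (dd : T -> 'rV[R]_m.+1) d : good theta z ->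
  (forall k, fmap (fun x => dd x 0 k) F --> d 0 k) ->
  fmap (fun x => Hfun f (th x) (zz x) (dd x)) F --> Hfun f theta z d.
Proof.
move=> [zr zer fz l8] dk.
apply: cvgCB.
  apply: cvgCM; last exact: (cvg_real (dk ord0)).
  by apply: cvgCM; [exact: cvgC_cst|exact: th_lim].
apply: cvgC_sum => j _; apply: cvgCM; first exact: (cvg_real (dk (lift ord0 j))).
exact: (cvgC_comp (log_arg_cvg zr zer (fz j)) (analytic_continuous (analytic_lnC (l8 j)))).
Qed.

End LogArgLimit.

(** The neighbourhood is joint in z and theta, the form from which compactness of Z(D) extracts one
    radius for theta. At theta = 0 every [log_arg] equals 1. *)
Lemma good_near_theta0 z : disk r z -> (forall j, f j z != 0) ->
  \forall z' \near z & theta \near (0 : R[i]), good theta z'.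
Proof.
move=> zr fz.
have cz : fmap fst (filter_prod (nbhs z) (nbhs (0 : R[i]))) --> z by exact: cvg_fst.
have ct : fmap snd (filter_prod (nbhs z) (nbhs (0 : R[i]))) --> (0 : R[i]) by exact: cvg_snd.
have zer : disk r (z * e 0) by rewrite expC_i0 mulr1.
have nr u (g : R[i] * R[i] -> R[i]) :
    disk r u -> fmap g (filter_prod (nbhs z) (nbhs (0 : R[i]))) --> u ->
    \forall x \near filter_prod (nbhs z) (nbhs (0 : R[i])), disk r (g x).
  move=> ur /cvgC_lt gu.
  have ru : 0 < r - normc u by rewrite subr_gt0.
  apply: filterS (gu _ ru) => x gx; rewrite /disk /=.
  rewrite (_ : g x = (g x - u) + u); last by ring.
  by apply: le_lt_trans (le_normcD _ _) _; lra.
have h1 := nr _ _ zr cz.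
have h2 : \forall x \near filter_prod (nbhs z) (nbhs (0 : R[i])), disk r (x.1 * e x.2).
  exact: (nr _ _ zer (rotation_cvg ct cz)).
(* A deviation smaller than |f_j z| prevents f_j from vanishing. *)
have h3 : \forall x \near filter_prod (nbhs z) (nbhs (0 : R[i])), forall j,
    normc (f j x.1 - f j z) < normc (f j z).
  apply: filter_forall => j.
  have fz0 : 0 < normc (f j z) by rewrite normc_gt0.
  exact: (cvgC_lt (cvgC_comp cz (analytic_continuous (f_analytic j zr))) fz0).
have h4 : \forall x \near filter_prod (nbhs z) (nbhs (0 : R[i])), forall j,
    normc (log_arg f j x.2 x.1 - 1) < 8^-1.
  apply: filter_forall => j.
  have l1 : log_arg f j 0 z = 1 by rewrite /log_arg expC_i0 mulr1 mulfV.
  have e8 : 0 < 8^-1 :> R by rewrite invr_gt0.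
  have h : \forall x \near filter_prod (nbhs z) (nbhs (0 : R[i])),
      normc (log_arg f j x.2 x.1 - log_arg f j 0 z) < 8^-1.
    exact: (cvgC_lt (log_arg_cvg ct cz zr zer (fz j)) e8).
  by rewrite l1 in h.
suff h : \forall x \near filter_prod (nbhs z) (nbhs (0 : R[i])), good x.2 x.1 by [].
apply: filterS2 (filterI h1 h2) (filterI h3 h4) => -[z' theta] /= [a b] [c l].
split => // j; apply/eqP => fz'0; have := c j.
by rewrite fz'0 sub0r normcN ltxx.
Qed.

Lemma analytic_Hfun theta z d : good theta z -> analytic_at (fun u => Hfun f u z d) theta.
Proof.
move=> [zr zer fz l8].
have hs : analytic_at (fun u => \sum_(j < m) (dj d j)%:C * lnC (log_arg f j u z)) theta.
  apply: analytic_sum => j; apply: analyticZ.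
  have h1 : analytic_at (fun u => z * e u) theta := analyticZ z (analytic_expCi theta).
  have h2 := analyticZ (f j z)^-1 (analytic_comp h1 (f_analytic j zer)).
  have h3 : analytic_at (fun u => log_arg f j u z) theta.
    by apply: analytic_near h2; apply/nbhs_normcP; exists 1 => // u _; rewrite mulrC.
  exact: (analytic_comp h3 (analytic_lnC (l8 j))).
have := analyticD (analyticZ ('i * (d0 d)%:C) (analytic_id theta)) (analyticZ (-1) hs).
apply: analytic_near; apply/nbhs_normcP; exists 1 => // u _.
by rewrite /Hfun mulN1r mulrAC.
Qed.

Definition log_deriv j z := (f j)^`()%classic z / f j z.

Lemma is_cderive_Hfun_theta0 z d : disk r z -> (forall j, f j z != 0) ->
  is_cderive 0 (fun u => Hfun f u z d)
    ('i * ((d0 d)%:C - \sum_(j < m) (dj d j)%:C * (z * log_deriv j z))).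
Proof.
move=> zr fz.
have l1 j : log_arg f j 0 z = 1 by rewrite /log_arg expC_i0 mulr1 mulfV.
have dl j : is_cderive 0 (fun u => lnC (log_arg f j u z)) ('i * (z * log_deriv j z)).
  have ze : z * e 0 = z by rewrite expC_i0 mulr1.
  have h1 := is_cderiveZ z (is_cderive_expCi 0); rewrite expC_i0 mul1r in h1.
  have h2 : is_cderive (z * e 0) (f j) ((f j)^`()%classic z).
    by rewrite ze; exact: (analytic_is_cderive (f_analytic j zr)).
  have h3 := is_cderiveZ (f j z)^-1 (is_cderive_comp h1 h2).
  have h4 : is_cderive 0 (fun u => log_arg f j u z)
      ((f j z)^-1 * ((f j)^`()%classic z * (z * 'i))).
    by apply: is_cderive_near h3; apply/nbhs_normcP; exists 1 => // u _; rewrite mulrC.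
  have h5 : is_cderive (log_arg f j 0 z) (@lnC R) 1 by rewrite l1; exact: is_cderive_lnC1.
  have := is_cderive_comp h4 h5; rewrite mul1r.
  by rewrite (_ : _ * _ = 'i * (z * log_deriv j z))//; rewrite /log_deriv; ring.
have h1 := is_cderive_sum (fun j => is_cderiveZ (dj d j)%:C (dl j)).
have h2 := is_cderiveB (is_cderiveZ ('i * (d0 d)%:C) (is_cderive_id 0)) h1.
have E : 'i * ((d0 d)%:C - \sum_(j < m) (dj d j)%:C * (z * log_deriv j z)) =
    'i * (d0 d)%:C * 1 - \sum_(j < m) (dj d j)%:C * ('i * (z * log_deriv j z)).
  rewrite mulr1 mulrBr mulr_sumr; congr (_ - _); apply: eq_bigr => j _.
  by rewrite mulrCA.
rewrite E; apply: is_cderive_near h2; apply/nbhs_normcP; exists 1 => // u _.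
by rewrite /Hfun mulrAC.
Qed.

Lemma Hfun_theta0 z d : (forall j, f j z != 0) -> Hfun f 0 z d = 0.
Proof.
move=> fz; rewrite /Hfun mulr0 mul0r big1 ?subr0// => j _.
by rewrite /log_arg expC_i0 mulr1 mulfV// lnC1 mulr0.
Qed.

Lemma modulus_prodE d x : (forall j, f j x != 0) ->
  modulus_prod f d x = expR (\sum_(j < m) dj d j * ln (normc (f j x))).
Proof.
move=> fx; rewrite /modulus_prod expR_sum; apply: eq_bigr => j _.
by rewrite /powR gt_eqF// normc_gt0.
Qed.

(** For real t the linear term is purely imaginary and Re lnC is the logarithm of the modulus, so Re
    H compares [modulus_prod] at z and at z e^(it), on the same circle. The two points differ
    exactly because z is nonzero and t is not in 2 pi Z. *)
Lemma Re_Hfun_gt0 (t : R) z d : good t%:C z -> strictly_minimal_critical_point r f d z ->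
  z != 0 -> ~ (exists k : int, t = k%:~R * (2 * pi)) -> 0 < complex.Re (Hfun f t%:C z d).
Proof.
move=> [zr zer fz l8] [[_ _ max _] uniq] z0 tk.
pose x := z * e t%:C.
have xz : normc x = normc z by rewrite normcM normc_expCi_real mulr1.
have fx j : f j x != 0.
  by have := near1_neq0 (l8 j); apply: contraNneq => fx; rewrite /log_arg -/x fx mul0r.
have lt : modulus_prod f d x < modulus_prod f d z.
  rewrite lt_neqAle max// andbT; apply/eqP => /(uniq _ xz) zx.
  apply: tk; apply: expCi_real_eq1; apply: (mulfI z0).
  by rewrite mulr1.
move: lt; rewrite !modulus_prodE// ltr_expR -subr_gt0 -sumrB => lt.
suff -> : complex.Re (Hfun f t%:C z d) =
    \sum_(j < m) (dj d j * ln (normc (f j z)) - dj d j * ln (normc (f j x))) by [].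
rewrite /Hfun raddfB raddf_sum /= (_ : _ * _ - _ = 0); last by ring.
rewrite sub0r -sumrN; apply: eq_bigr => j _.
rewrite mul0r subr0 /log_arg normcM normcV ln_div ?posrE ?normc_gt0// -/x.
by rewrite mulrBr opprB.
Qed.

End PhaseFunction.

(** * The function H near z = 0 *)

Section PhaseNearZero.
Context {R : realType} (m : nat) (r : R) (f : 'I_m -> R[i] -> R[i]).
Hypothesis r_gt0 : 0 < r.
Hypothesis f_analytic : forall j z, disk r z -> analytic_at (f j) z.
Hypothesis f0 : forall j, f j 0 != 0.
Implicit Types (z w theta u : R[i]) (d : 'rV[R]_m.+1).

Local Notation e theta := (expC ('i * theta)).

Let disk0 : disk r (0 : R[i]).
Proof. by have : normc (0 : R[i]) < r by rewrite normc0. Qed.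

(** The constant 1/24 makes quotients good: if a and b are within 1/24 of 1, then |a / b - 1| <=
    (1/12) / (23/24) = 2/23 < 1/8. *)
Definition near0 z := disk r z /\ forall j, normc (f j z / f j 0 - 1) < 24^-1.

Lemma near0_ball : exists2 delta : R, 0 < delta & forall z, normc z < delta -> near0 z.
Proof.
have h : \forall z \near (0 : R[i]), forall j, normc (f j z / f j 0 - 1) < 24^-1.
  apply: (@filter_forall _ _ (fun j z => normc (f j z / f j 0 - 1) < 24^-1)
    (nbhs (0 : R[i])) _) => j.
  have e24 : 0 < 24^-1 :> R by rewrite invr_gt0.
  have h : \forall z \near (0 : R[i]), normc (f j z / f j 0 - f j 0 / f j 0) < 24^-1.
    exact: (cvgC_lt (cvgCM (analytic_continuous (f_analytic j disk0))
      (@cvgC_cst _ _ _ _ (f j 0)^-1)) e24).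
  by rewrite mulfV in h.
have /nbhs_normcP[delta delta0 dP] := h.
exists (Num.min r delta); first by rewrite lt_min r_gt0.
by move=> z; rewrite lt_min => /andP[zr zd]; split=> //; apply: dP; rewrite subr0.
Qed.

(** Since |e^(i theta)| <= e^T on the disk of radius T, shrinking the radius for z by e^T handles an
    arbitrarily large Theta. *)
Lemma rotation_near0 (T : R) : 0 < T ->
  exists2 delta, 0 < delta & forall theta z, normc theta < T -> normc z < delta ->
    near0 z /\ near0 (z * e theta).
Proof.
move=> T0; have [delta delta0 dP] := near0_ball.
exists (delta / expR T); first by rewrite divr_gt0 ?expR_gt0.
move=> theta z tT; rewrite ltr_pdivlMr ?expR_gt0// => zd; split; apply: dP.
  apply: le_lt_trans zd; rewrite ler_peMr ?normc_ge0//.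
  by apply: le_trans (expR_ge1Dx T); lra.
rewrite normcM; apply: le_lt_trans zd; rewrite ler_wpM2l ?normc_ge0//.
by apply: le_trans (normc_expCi_le theta) _; rewrite ler_expR ltW.
Qed.

Lemma near0_near1 z j : near0 z -> normc (f j z / f j 0 - 1) < 8^-1.
Proof. by move=> [_ /(_ j)]; lra. Qed.

Lemma near0_neq0 z j : near0 z -> f j z != 0.
Proof.
move=> /(near0_near1 j)/near1_neq0; apply: contraNneq => ->.
by rewrite mul0r.
Qed.

Lemma near0_log_arg theta z j :
  log_arg f j theta z = (f j (z * e theta) / f j 0) / (f j z / f j 0).
Proof. by rewrite /log_arg invfM invrK mulrACA mulVf// mulr1. Qed.

Lemma near0_good theta z : near0 z -> near0 (z * e theta) -> good r f theta z.
Proof.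
move=> nz nze; have [zr az] := nz; have [zer aze] := nze.
split => // j; first exact: near0_neq0.
rewrite near0_log_arg; have := az j; have := aze j; have := near1_neq0 (near0_near1 j nz).
set a := f j (z * _) / f j 0; set b := f j z / f j 0 => b0 a24 b24.
rewrite (_ : a / b - 1 = ((a - 1) - (b - 1)) / b); last by field.
rewrite normcM normcV ltr_pdivrMr ?normc_gt0//.
have : 1 <= normc b + 24^-1.
  rewrite -{1}(@normc1 R) (_ : 1 = b - (b - 1) :> R[i]); last by ring.
  by apply: le_trans (le_normcD _ _) _; rewrite normcN lerD2l ltW.
have := le_normcD (a - 1) (- (b - 1)); rewrite normcN; lra.
Qed.

(** The p_j of the overview, with its removable singularity at 0 filled by the derivative of the
    logarithm there. *)
Definition log_quot j z :=
  if z == 0 then log_deriv f j 0 else lnC (f j z / f j 0) / z.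

Lemma mul_log_quot j z : z * log_quot j z = lnC (f j z / f j 0).
Proof.
rewrite /log_quot; case: eqVneq => [->|z0]; first by rewrite mul0r mulfV// lnC1.
by rewrite mulrC divfK.
Qed.

(** Away from 0, [log_quot] is the Caratheodory quotient at 0 of ln (f_j / f_j 0). *)
Lemma log_quot_continuous j : fmap (log_quot j) (nbhs 0) --> log_quot j 0.
Proof.
have l1 : f j 0 / f j 0 = 1 by rewrite mulfV.
have h1 := is_cderiveM (analytic_is_cderive (f_analytic j disk0))
  (is_cderive_cst 0 (f j 0)^-1).
have h2 : is_cderive (f j 0 / f j 0) (@lnC R) 1 by rewrite l1; exact: is_cderive_lnC1.
have := is_cderive_comp h1 h2; rewrite mulr0 add0r mul1r mulrC -/(log_deriv f j 0).
move=> /is_cderiveP[q q0 qE]; rewrite {2}/log_quot eqxx.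
apply: (cvgC_lip_normc (k := 1) q0); apply/nbhs_normcP; exists 1 => // z _.
rewrite mul1r /log_quot; case: eqVneq => [->|z0].
  by rewrite subrr normc0 normc_ge0.
by rewrite qE l1 lnC1 add0r subr0 mulfK.
Qed.

Lemma log_deriv_continuous j : fmap (log_deriv f j) (nbhs 0) --> log_deriv f j 0.
Proof.
have fa := f_analytic j disk0.
exact: (cvgCM (analytic_derive_continuous fa) (cvgCV (f0 j) (analytic_continuous fa))).
Qed.

Definition Gfun theta z d : R[i] :=
  'i * theta * (\sum_(j < m) (dj d j)%:C * log_deriv f j z)
  - \sum_(j < m) (dj d j)%:C * (e theta * log_quot j (z * e theta) - log_quot j z).

Lemma sum_log_arg theta z d : near0 z -> near0 (z * e theta) ->
  \sum_(j < m) (dj d j)%:C * lnC (log_arg f j theta z) =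
  z * \sum_(j < m) (dj d j)%:C * (e theta * log_quot j (z * e theta) - log_quot j z).
Proof.
move=> nz nze; rewrite mulr_sumr; apply: eq_bigr => j _.
rewrite near0_log_arg lnC_div ?near0_near1// -!mul_log_quot; ring.
Qed.

Lemma Hfun_factor theta z d : near0 z -> near0 (z * e theta) ->
  (d0 d)%:C = \sum_(j < m) (dj d j)%:C * (z * log_deriv f j z) ->
  Hfun f theta z d = z * Gfun theta z d.
Proof.
move=> nz nze dE; rewrite /Hfun sum_log_arg// dE /Gfun mulrBr; congr (_ - _).
rewrite mulrCA; congr (_ * _); rewrite mulr_sumr; apply: eq_bigr => j _.
by rewrite mulrCA.
Qed.

Lemma Gfun_cvg (T : Type) (F : set_system T) {FF : Filter F}
    (th zz : T -> R[i]) (dd : T -> 'rV[R]_m.+1) theta d :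
  fmap th F --> theta -> fmap zz F --> (0 : R[i]) ->
  (forall k, fmap (fun x => dd x 0 k) F --> d 0 k) ->
  fmap (fun x => Gfun (th x) (zz x) (dd x)) F --> Gfun theta 0 d.
Proof.
move=> tht zz0 dk.
have ec := cvgC_comp tht (analytic_continuous (analytic_expCi theta)).
have rc : fmap (fun x => zz x * e (th x)) F --> (0 : R[i]).
  rewrite -(mul0r (e theta)); exact: (cvgCM zz0 (ec FF)).
have dc j := cvg_real (dk (lift ord0 j)).
apply: cvgCB.
  apply: cvgCM; first by apply: cvgCM; [exact: cvgC_cst|exact: tht].
  apply: cvgC_sum => j _; apply: cvgCM; first exact: dc.
  exact: (cvgC_comp zz0 (@log_deriv_continuous j)).
apply: cvgC_sum => j _; apply: cvgCM; first exact: dc.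
apply: cvgCB; last exact: (cvgC_comp zz0 (@log_quot_continuous j)).
apply: cvgCM; first exact: ec.
rewrite mul0r; exact: (cvgC_comp rc (@log_quot_continuous j)).
Qed.

(** With d_0 = 0, H = z g(z) for all z near 0, and continuity of g at 0 already gives the derivative
    g 0. *)
Lemma is_cderive_Hfun_z0 theta d : d0 d = 0 ->
  is_cderive 0 (fun z => Hfun f theta z d)
    (- \sum_(j < m) (dj d j)%:C * (e theta * log_quot j 0 - log_quot j 0)).
Proof.
move=> d00.
pose g z := - \sum_(j < m) (dj d j)%:C * (e theta * log_quot j (z * e theta) - log_quot j z).
have g0 : - \sum_(j < m) (dj d j)%:C * (e theta * log_quot j 0 - log_quot j 0) = g 0.
  by rewrite /g mul0r.
have gc : fmap g (nbhs 0) --> g 0.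
  have idc : fmap (fun z : R[i] => z) (nbhs (0 : R[i])) --> (0 : R[i]) by exact: cvg_id.
  have rc : fmap (fun z : R[i] => z * e theta) (nbhs (0 : R[i])) --> (0 : R[i]).
    rewrite -[X in _ --> X](mul0r (e theta)); exact: (cvgCM idc (@cvgC_cst _ _ _ _ (e theta))).
  apply: cvgCN; apply: cvgC_sum => j _; apply: cvgCM; first exact: cvgC_cst.
  apply: cvgCB; last exact: log_quot_continuous.
  apply: cvgCM; first exact: cvgC_cst.
  rewrite mul0r; exact: (cvgC_comp rc (@log_quot_continuous j)).
rewrite g0; apply: is_cderive_near (is_cderive_mul0 gc).
(* Any radius exceeding |theta| would do. *)
have T0 : 0 < normc theta + 1 by rewrite ltr_wpDl ?normc_ge0.
have [delta delta0 dP] := rotation_near0 T0.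
apply/nbhs_normcP; exists delta => // z; rewrite subr0 => zd.
have [nz nze] : near0 z /\ near0 (z * e theta) by apply: dP => //; rewrite ltrDl.
by rewrite /Hfun sum_log_arg// d00 mulr0 sub0r /g mulrN.
Qed.

(** Again z times a function continuous at 0; that continuity rests on the continuity of f_j'. *)
Lemma is_cderive_dHfun d : d0 d = 0 ->
  is_cderive 0 (fun z => (fun u => Hfun f u z d)^`()%classic 0)
    (- 'i * \sum_(j < m) (dj d j)%:C * log_deriv f j 0).
Proof.
move=> d00.
pose g z := - 'i * \sum_(j < m) (dj d j)%:C * log_deriv f j z.
have gc : fmap g (nbhs 0) --> g 0.
  apply: cvgCM; first exact: cvgC_cst.
  apply: cvgC_sum => j _; apply: cvgCM; first exact: cvgC_cst.
  exact: log_deriv_continuous.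
apply: is_cderive_near (is_cderive_mul0 gc).
have [delta delta0 dP] := near0_ball.
apply/nbhs_normcP; exists delta => // z; rewrite subr0 => /dP nz.
rewrite (is_cderive_derive1 (is_cderive_Hfun_theta0 f_analytic d (proj1 nz)
  (fun j => near0_neq0 j nz))).
rewrite d00 /g mulrCA mulNr -mulrN; congr (_ * _).
by rewrite sub0r mulr_sumr; congr (- _); apply: eq_bigr => j _; rewrite mulrCA.
Qed.

End PhaseNearZero.

(** * Limits along Lambda *)

Section LambdaLimits.
Context {R : realType} (m : nat) (D : set 'rV[R]_m.+1) (Z : 'rV[R]_m.+1 -> R[i]).
Hypothesis Z_continuous : {within D, continuous Z}.
Variables (L : set (R[i] * 'rV[R]_m.+1)) (p : R[i] * 'rV[R]_m.+1).
Hypothesis LD : forall q, L q -> D q.2.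

Lemma within_theta_cvg : fmap fst (within L (nbhs p)) --> p.1.
Proof. by apply: cvg_within_filter; exact: cvg_fst. Qed.

(** Z is continuous only relative to D, so the limit is taken along L, whose second coordinates lie
    in D. *)
Lemma within_Z_cvg : L p -> fmap (fun q => Z q.2) (within L (nbhs p)) --> Z p.2.
Proof.
move=> Lp; have /subspace_continuousP/(_ _ (LD Lp)) Zp := Z_continuous.
move=> P /Zp DP.
have DP' : nbhs p.2 (fun d => D d -> P (Z d)) by exact: DP.
have sp : nbhs p (fun q : R[i] * 'rV[R]_m.+1 => D q.2 -> P (Z q.2)).
  exact: (@filter_prod2 _ _ (nbhs p.1) (nbhs p.2) _ _ DP').
rewrite /= /within; apply: filterS sp => q h Lq.
by apply: h; exact: LD.
Qed.

Lemma within_coord_cvg k :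
  fmap (fun q : R[i] * 'rV[R]_m.+1 => q.2 0 k) (within L (nbhs p)) --> p.2 0 k.
Proof.
have h : fmap snd (nbhs p) --> p.2 by exact: (@cvg_snd _ _ (nbhs p.1) (nbhs p.2) _).
apply: cvg_within_filter.
exact: (cvg_comp _ _ h (@coord_continuous _ _ _ 0 k p.2)).
Qed.

End LambdaLimits.

Theorem theorem2 (R : realType) (m : nat) (hm : (1 <= m)%N)
    (N : 'rV[R]_m.+1 -> R) (hN : is_norm N)
    (r : R) (hr : 0 < r)
    (f : 'I_m -> R[i] -> R[i])
    (f_analytic : forall j z, disk r z -> analytic_at (f j) z)
    (f_nonconstant : forall j, ~ constant_on (disk r) (f j))
    (f0 : forall j, f j 0 != 0)
    (D : set 'rV[R]_m.+1)
    (D_sphere : D `<=` sphere_plus N) (D_compact : compact D)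
    (Z : 'rV[R]_m.+1 -> R[i])
    (Z_disk : forall d, D d -> disk r (Z d))
    (Z_continuous : {within D, continuous Z})
    (Z_critical : forall d, D d -> strictly_minimal_critical_point r f d (Z d)) :
  forall T : R, 0 < T ->
  exists B : R, [/\ 0 < B, B <= T &
    let F := Ffun f Z in
    let H := Hfun f in
    let L := Lambda T B D Z in
    [/\ (forall theta d, L (theta, d) -> H_defined r f theta (Z d))
          /\ {within L, continuous (fun p => F p.1 p.2)},
        (* (a) *)
        (forall theta d, L (theta, d) -> analytic_at (F^~ d) theta)
          /\ (forall d, D d ->
                F 0 d = 0 /\ is_derive (0 : R[i]) 1 (F^~ d) (0 : R[i])),
        (* (b), for real theta outside 2 pi Z *)
        forall (t : R) d, L (t%:C, d) ->
          ~ (exists k : int, t = k%:~R * (2 * pi)) -> Z d != 0 ->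
          0 < complex.Re (F t%:C d)
      & exists G : R[i] -> 'rV[R]_m.+1 -> R[i],
        [/\ {within L, continuous (fun p => G p.1 p.2)},
            (* (c) *)
            forall theta d, L (theta, d) -> F theta d = Z d * G theta d
          & (* (d) *)
            forall theta d, L (theta, d) -> Z d = 0 ->
              let dH_dz (u : R[i]) := (fun z => H u z d)^`()%classic 0 in
              let dH_dtheta (z : R[i]) := (fun u => H u z d)^`()%classic 0 in
              [/\ derivable (fun z => H theta z d) 0 1,
                  \forall z \near (0 : R[i]), derivable (fun u => H u z d) 0 1,
                  derivable dH_dtheta 0 1
                & G theta d = dH_dz theta - theta * dH_dtheta^`()%classic 0]]]].
Proof.
move=> T T0.
have fa j z : disk r z -> analytic_at (f j) z := @f_analytic j z.
have fZ d j : D d -> f j (Z d) != 0 by move=> /Z_critical[[]].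
have dE d : D d -> (d0 d)%:C = \sum_(j < m) (dj d j)%:C * (Z d * log_deriv f j (Z d)).
  move=> /Z_critical[[_ _ _ ->] _]; apply: eq_bigr => j _.
  by congr (_ * _); rewrite /log_deriv mulrA.
have [delta delta0 deltaP] := rotation_near0 hr fa f0 T0.
have [B1 B10 B1P] : exists2 B1 : R, 0 < B1 &
    forall theta d, normc theta < B1 -> D d -> good r f theta (Z d).
  have := continuous_compact Z_continuous D_compact => /compact_near_coveringP Kc.
  have cov z : (Z @` D) z -> \forall z' \near z & theta \near nbhs (0 : R[i]),
      good r f theta z'.
    by move=> [d Dd <-]; apply: (good_near_theta0 fa (Z_disk d Dd)) => j; exact: fZ.
  have /nbhs_normcP[B1 B10 B1P] : nbhs (0 : R[i]) (fun theta => Z @` D `<=` good r f theta).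
    exact: (Kc _ (nbhs (0 : R[i])) (good r f) _ cov).
  exists B1 => // theta d tB Dd; apply: (B1P theta); first by rewrite subr0.
  by exists d.
(* T gives the inclusion in Theta, delta makes Z(d) small enough for every theta in Theta, and B1
   covers the piece of Lambda where d is arbitrary in D. *)
pose B := Num.min T (Num.min delta B1).
have BT : B <= T by rewrite ge_min lexx.
have Bd : B <= delta by rewrite !ge_min lexx orbT.
have BB1 : B <= B1 by rewrite !ge_min lexx !orbT.
exists B; split; [by rewrite !lt_min T0 delta0|exact: BT|].
move=> F H L.
have LD q : L q -> D q.2 by case=> [[_ []]|[]].
have LT q : L q -> normc q.1 < T.
  by case=> [[]//|[h _]]; exact: lt_le_trans h BT.
have Lgood theta d : L (theta, d) -> good r f theta (Z d).
  case=> [[tT [_ ZB]]|[tB Dd]]; last by apply: B1P => //; exact: lt_le_trans tB BB1.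
  by have [] := deltaP theta (Z d) tT (lt_le_trans ZB Bd); exact: near0_good.
have Fcont p : L p -> fmap (fun q => F q.1 q.2) (within L (nbhs p)) --> F p.1 p.2.
  move=> Lp; apply: (Hfun_cvg fa (@within_theta_cvg _ _ L p)
    (within_Z_cvg Z_continuous LD Lp)).
    by apply: Lgood; rewrite -surjective_pairing.
  by move=> k; exact: within_coord_cvg.
split.
- split; first by move=> theta d /Lgood; exact: good_H_defined.
  exact/subspace_continuousP.
- split; first by move=> theta d /Lgood; exact: analytic_Hfun.
  move=> d Dd; split; first by apply: Hfun_theta0 => j; exact: fZ.
  have := is_cderive_Hfun_theta0 fa d (Z_disk d Dd) (fun j => fZ d j Dd).
  by rewrite -dE// subrr mulr0.
- move=> t d Ltd tk Zd0.
  exact: (Re_Hfun_gt0 (Lgood _ _ Ltd) (Z_critical d (LD _ Ltd)) Zd0 tk).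
pose G theta d := if Z d == 0 then Gfun f theta 0 d else F theta d / Z d.
have FG theta d : normc theta < T -> normc (Z d) < delta -> D d ->
    F theta d = Z d * Gfun f theta (Z d) d.
  move=> tT Zd Dd; have [nz nze] := deltaP theta (Z d) tT Zd.
  exact: (Hfun_factor f0 nz nze (dE d Dd)).
(* The two branches of [G] are one formula wherever |Z d| < delta, so continuity at the zeros of Z
   reduces to that of [Gfun]. *)
have GE theta d : normc theta < T -> normc (Z d) < delta -> D d ->
    G theta d = Gfun f theta (Z d) d.
  move=> tT Zd Dd; rewrite /G; case: eqVneq => [->//|Z0].
  by rewrite FG// mulrC mulKf.
exists G; split.
- apply/subspace_continuousP => p Lp.
  suff : fmap (fun q => G q.1 q.2) (within L (nbhs p)) --> G p.1 p.2 by [].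
  have Zc := within_Z_cvg Z_continuous LD Lp.
  have Lnear : \forall q \near within L (nbhs p), L q by exact: withinT.
  have [Z0|Z0] := eqVneq (Z p.2) 0.
    have -> : G p.1 p.2 = Gfun f p.1 0 p.2 by rewrite /G Z0 eqxx.
    rewrite Z0 in Zc.
    have Zsmall : \forall q \near within L (nbhs p), normc (Z q.2 - 0) < delta.
      exact: (cvgC_lt Zc delta0).
    apply: (cvgC_near_eq _ (Gfun_cvg hr fa f0 (@within_theta_cvg _ _ L p) Zc
      (@within_coord_cvg _ _ L p))).
    apply: (@filterS2 _ (within L (nbhs p)) _ _ _ _ _ Lnear Zsmall) => q Lq.
    rewrite subr0 => Zq.
    by rewrite GE//; [exact: LT|exact: LD].
  have -> : G p.1 p.2 = F p.1 p.2 * (Z p.2)^-1 by rewrite /G (negbTE Z0).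
  have Zp0 : 0 < normc (Z p.2) by rewrite normc_gt0.
  apply: (cvgC_near_eq _ (cvgCM (Fcont p Lp) (cvgCV Z0 Zc))).
  (* Being closer to Z p.2 than 0 is, Z q.2 cannot vanish, so [G] is the quotient near p. *)
  have Znear : \forall q \near within L (nbhs p), normc (Z q.2 - Z p.2) < normc (Z p.2).
    exact: (cvgC_lt Zc Zp0).
  apply: (@filterS _ (within L (nbhs p)) _ _ _ _ Znear) => q Zq.
  rewrite /G; case: eqVneq Zq => [->|//].
  by rewrite sub0r normcN ltxx.
- move=> theta d Ld; rewrite /G; case: eqVneq => [Z0|Z0]; last by rewrite mulrC divfK.
  have Zd : normc (Z d) < delta by rewrite Z0 normc0.
  by rewrite (FG theta d (LT _ Ld) Zd (LD _ Ld)) Z0.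
- move=> theta d Ld Z0 dH_dz dH_dtheta.
  have Dd := LD _ Ld.
  (* Every term of the critical point equation carries the factor Z d = 0. *)
  have d00 : d0 d = 0.
    apply: complexI; rewrite dE// Z0 big1// => j _.
    by rewrite mul0r mulr0.
  have hz := is_cderive_Hfun_z0 hr fa f0 theta d00.
  have ht := is_cderive_dHfun hr fa f0 d00.
  split.
  + by case: hz.
  + have [eps eps0 epsP] := near0_ball hr fa f0.
    apply/nbhs_normcP; exists eps; [exact: eps0|move=> z; rewrite subr0 => /epsP nz].
    by have [] := is_cderive_Hfun_theta0 fa d (proj1 nz) (fun j => near0_neq0 j nz).
  + by case: ht.
  + rewrite /dH_dz (is_cderive_derive1 hz) /dH_dtheta (is_cderive_derive1 ht).
    rewrite /G Z0 eqxx /Gfun mul0r; ring.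
Qed.
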